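(* Suppose $\mathcal{V}=\mathrm{Sind}\,\mathbf{Set}_{fin}$. Then an endofunctor of $\mathcal{V}$ (i.e. a $\mathcal{V}$-functor $T:\mathcal{V}\to\mathcal{V}$) is strongly finitary if and only if it preserves sifted colimits.
   Context: $\mathcal{V}=(\mathcal{V}_o,\otimes,I)$ is a closed symmetric monoidal category which is complete and cocomplete (has weighted limits and colimits), and the functor $K:\mathbf{Set}_{fin}\to\mathcal{V}$, $KX=\coprod_X I$, from the category of finite sets is assumed to be a full embedding; $\mathbf{Set}_{fin}$ is regarded via $K$ as a full sub-$\mathcal{V}$-category of $\mathcal{V}$. A weight $W:\mathscr{D}^{op}\to\mathcal{V}$ ($\mathscr{D}$ a small $\mathcal{V}$-category) is sifted if colimits of diagrams in $\mathcal{V}$ weighted by $W$ commute with finite products; a sifted colimit is a colimit weighted by a sifted weight. ''$\mathcal{V}=\mathrm{Sind}\,\mathbf{Set}_{fin}$'' means that $\mathcal{V}$ is the free completion of $\mathbf{Set}_{fin}$ under sifted colimits via $K$: for every $\mathcal{V}$-category $\mathscr{L}$ with sifted colimits, precomposition with $K$ is an equivalence from the category of sifted-colimit-preserving $\mathcal{V}$-functors $\mathcal{V}\to\mathscr{L}$ to $[\mathbf{Set}_{fin},\mathscr{L}]$. An endofunctor $T$ of $\mathcal{V}$ is strongly finitary if it is the ($\mathcal{V}$-enriched) left Kan extension of its restriction to finite sets: $T=\mathrm{Lan}_K(T\circ K)$. *)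

(* Defs.v *)
(* Hom-sets carry Leibniz equality; functional extensionality and proof
   irrelevance make V-natural transformations with equal components equal. *)
From mathcomp Require Import all_boot.
From Stdlib Require Import FunctionalExtensionality ProofIrrelevance.

Set Implicit Arguments.
Unset Strict Implicit.
Unset Printing Implicit Defensive.

Declare Scope cat_scope.
Delimit Scope cat_scope with cat.
Local Open Scope cat_scope.

Reserved Notation "g ∘ f" (at level 40, left associativity).
Reserved Notation "x ⊗ y" (at level 38, right associativity).
Reserved Notation "f ⊠ g" (at level 38, right associativity).

Record Category := {
  ob :> Type;
  Hom : ob -> ob -> Type;
  idm : forall x, Hom x x;
  comp : forall x y z, Hom y z -> Hom x y -> Hom x z;
  comp1m : forall x y (f : Hom x y), comp (idm y) f = f;
  compm1 : forall x y (f : Hom x y), comp f (idm x) = f;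
  compA : forall w x y z (h : Hom y z) (g : Hom x y) (f : Hom w x),
    comp h (comp g f) = comp (comp h g) f }.

Arguments Hom {c} x y.
Arguments idm {c} x.
Arguments comp {c x y z} g f.
Notation "g ∘ f" := (comp g f) : cat_scope.

Definition is_iso (C : Category) (x y : C) (f : Hom x y) : Prop :=
  exists g : Hom y x, g ∘ f = idm x /\ f ∘ g = idm y.

Record Functor (C D : Category) := {
  fobj :> C -> D;
  fmap : forall x y, Hom x y -> Hom (fobj x) (fobj y);
  fmap1 : forall x, fmap (idm x) = idm (fobj x);
  fmapM : forall x y z (g : Hom y z) (f : Hom x y),
    fmap (g ∘ f) = fmap g ∘ fmap f }.

Arguments fmap {C D} f0 {x y} f.

Definition functor_id (C : Category) : Functor C C :=
  @Build_Functor C C id (fun _ _ f => f) (fun=> erefl) (fun _ _ _ _ _ => erefl).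

Program Definition functor_comp (C D E : Category)
    (G : Functor D E) (F : Functor C D) : Functor C E :=
  @Build_Functor C E (fun x => G (F x)) (fun _ _ f => fmap G (fmap F f)) _ _.
Next Obligation. by move=> *; rewrite /= !fmap1. Qed.
Next Obligation. by move=> *; rewrite /= !fmapM. Qed.

Definition naturally_isomorphic (C D : Category) (F G : Functor C D) : Prop :=
  exists eta : forall x, Hom (F x) (G x),
    (forall x y (f : Hom x y), fmap G f ∘ eta x = eta y ∘ fmap F f) /\
    (forall x, is_iso (eta x)).

Definition is_equivalence (C D : Category) (F : Functor C D) : Prop :=
  exists G : Functor D C,
    naturally_isomorphic (functor_comp G F) (functor_id C) /\
    naturally_isomorphic (functor_comp F G) (functor_id D).

Definition fully_faithful (C D : Category) (F : Functor C D) : Prop :=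
  forall x y : C, bijective (fun f : Hom x y => fmap F f).

Definition full_subcategory (C : Category) (P : C -> Prop) : Category :=
  {| ob := {x : C | P x};
     Hom x y := Hom (sval x) (sval y);
     idm x := idm (sval x);
     comp _ _ _ g f := g ∘ f;
     comp1m _ _ f := comp1m f;
     compm1 _ _ f := compm1 f;
     compA _ _ _ _ h g f := compA h g f |}.

Definition is_product (C : Category) (J : Type) (F : J -> C) (p : C)
    (pr : forall j, Hom p (F j)) : Prop :=
  forall (x : C) (f : forall j, Hom x (F j)),
    exists! h : Hom x p, forall j, pr j ∘ h = f j.

Definition FinSet : Category :=
  {| ob := finType;
     Hom X Y := X -> Y;
     idm X := id;
     comp _ _ _ g f := fun x => g (f x);
     comp1m _ _ _ := erefl;
     compm1 _ _ _ := erefl;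
     compA _ _ _ _ _ _ _ := erefl |}.

Definition small_universe := Type.

(* Besides being the motivating example, this forces the level of small types
   to lie strictly below the level of the objects of a category, so that
   smallness is a genuine restriction. *)
Definition SmallSet : Category :=
  {| ob := small_universe;
     Hom X Y := X -> Y;
     idm X := id;
     comp _ _ _ g f := fun x => g (f x);
     comp1m _ _ _ := erefl;
     compm1 _ _ _ := erefl;
     compA _ _ _ _ _ _ _ := erefl |}.

Record SMCC := {
  smcc_cat :> Category;
  tens : smcc_cat -> smcc_cat -> smcc_cat;
  tensm : forall x x' y y', Hom x x' -> Hom y y' -> Hom (tens x y) (tens x' y');
  tens1 : forall x y, tensm (idm x) (idm y) = idm (tens x y);
  tensM : forall x x' x'' y y' y'' (f' : Hom x' x'') (f : Hom x x')
      (g' : Hom y' y'') (g : Hom y y'),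
    tensm (f' ∘ f) (g' ∘ g) = tensm f' g' ∘ tensm f g;
  munit : smcc_cat;
  (* associator (x ⊗ y) ⊗ z -> x ⊗ (y ⊗ z) *)
  assoc : forall x y z, Hom (tens (tens x y) z) (tens x (tens y z));
  assoc_inv : forall x y z, Hom (tens x (tens y z)) (tens (tens x y) z);
  assocK : forall x y z, assoc_inv x y z ∘ assoc x y z = idm _;
  assocKV : forall x y z, assoc x y z ∘ assoc_inv x y z = idm _;
  assoc_nat : forall x x' y y' z z' (f : Hom x x') (g : Hom y y') (h : Hom z z'),
    assoc x' y' z' ∘ tensm (tensm f g) h = tensm f (tensm g h) ∘ assoc x y z;
  lunit : forall x, Hom (tens munit x) x;
  lunit_inv : forall x, Hom x (tens munit x);
  lunitK : forall x, lunit_inv x ∘ lunit x = idm _;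
  lunitKV : forall x, lunit x ∘ lunit_inv x = idm _;
  lunit_nat : forall x y (f : Hom x y), lunit y ∘ tensm (idm munit) f = f ∘ lunit x;
  runit : forall x, Hom (tens x munit) x;
  runit_inv : forall x, Hom x (tens x munit);
  runitK : forall x, runit_inv x ∘ runit x = idm _;
  runitKV : forall x, runit x ∘ runit_inv x = idm _;
  runit_nat : forall x y (f : Hom x y), runit y ∘ tensm f (idm munit) = f ∘ runit x;
  braid : forall x y, Hom (tens x y) (tens y x);
  braidK : forall x y, braid y x ∘ braid x y = idm _;
  braid_nat : forall x x' y y' (f : Hom x x') (g : Hom y y'),
    braid x' y' ∘ tensm f g = tensm g f ∘ braid x y;
  triangle : forall x y,
    tensm (idm x) (lunit y) ∘ assoc x munit y = tensm (runit x) (idm y);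
  pentagon : forall w x y z,
    assoc w x (tens y z) ∘ assoc (tens w x) y z =
    tensm (idm w) (assoc x y z) ∘ (assoc w (tens x y) z ∘ tensm (assoc w x y) (idm z));
  hexagon : forall x y z,
    assoc y z x ∘ (braid x (tens y z) ∘ assoc x y z) =
    tensm (idm y) (braid x z) ∘ (assoc y x z ∘ tensm (braid x y) (idm z));
  (* [- ⊗ y] is left adjoint to [ihom y -] *)
  ihom : smcc_cat -> smcc_cat -> smcc_cat;
  ev : forall y z, Hom (tens (ihom y z) y) z;
  curry : forall x y z, Hom (tens x y) z -> Hom x (ihom y z);
  ev_curry : forall x y z (f : Hom (tens x y) z),
    ev y z ∘ tensm (curry f) (idm y) = f;
  curry_ev : forall x y z (g : Hom x (ihom y z)),
    curry (ev y z ∘ tensm g (idm y)) = g }.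

Arguments tens {s} x y.
Arguments tensm {s x x' y y'} f g.
Arguments munit {s}.
Arguments assoc {s} x y z.
Arguments assoc_inv {s} x y z.
Arguments lunit {s} x.
Arguments lunit_inv {s} x.
Arguments runit {s} x.
Arguments runit_inv {s} x.
Arguments braid {s} x y.
Arguments ihom {s} x y.
Arguments ev {s} y z.
Arguments curry {s x y z} f.
Notation "x ⊗ y" := (tens x y) : cat_scope.
Notation "f ⊠ g" := (tensm f g) : cat_scope.

Section Coherence.
Variable V : SMCC.
Implicit Types x y z : V.

Lemma reassoc (C : Category) (w x y y' z : C) (f : Hom y z) (g : Hom x y)
    (f' : Hom y' z) (g' : Hom x y') : f ∘ g = f' ∘ g' ->
  forall h : Hom w x, f ∘ (g ∘ h) = f' ∘ (g' ∘ h).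
Proof. by move=> E h; rewrite compA E -compA. Qed.

Lemma reassoc1 (C : Category) (w x y z : C) (f : Hom y z) (g : Hom x y)
    (k : Hom x z) : f ∘ g = k -> forall h : Hom w x, f ∘ (g ∘ h) = k ∘ h.
Proof. by move=> E h; rewrite compA E. Qed.

Lemma reassoc_id (C : Category) (w x y : C) (f : Hom y x) (g : Hom x y) :
  f ∘ g = idm x -> forall h : Hom w x, f ∘ (g ∘ h) = h.
Proof. by move=> E h; rewrite compA E comp1m. Qed.

Lemma tens_split x x' y y' (f : Hom x x') (g : Hom y y') :
  f ⊠ g = (f ⊠ idm y') ∘ (idm x ⊠ g).
Proof. by rewrite -tensM comp1m compm1. Qed.

Lemma tens_swap x x' y y' (f : Hom x x') (g : Hom y y') :
  (idm x' ⊠ g) ∘ (f ⊠ idm y) = (f ⊠ idm y') ∘ (idm x ⊠ g).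
Proof. by rewrite -tensM -tensM !comp1m !compm1. Qed.

Lemma lunit_faithful x y (f g : Hom x y) :
  idm munit ⊠ f = idm munit ⊠ g -> f = g.
Proof.
move=> E; have : f ∘ lunit x = g ∘ lunit x by rewrite -!lunit_nat E.
move/(congr1 (fun h => h ∘ lunit_inv x)).
by rewrite -!compA lunitKV !compm1.
Qed.

Lemma runit_faithful x y (f g : Hom x y) :
  f ⊠ idm munit = g ⊠ idm munit -> f = g.
Proof.
move=> E; have : f ∘ runit x = g ∘ runit x by rewrite -!runit_nat E.
move/(congr1 (fun h => h ∘ runit_inv x)).
by rewrite -!compA runitKV !compm1.
Qed.

Lemma cancel_epi (C : Category) (x y z : C) (e : Hom x y) (s : Hom y x)
    (f g : Hom y z) : e ∘ s = idm y -> f ∘ e = g ∘ e -> f = g.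
Proof.
by move=> E /(congr1 (fun h => h ∘ s)); rewrite -!compA E !compm1.
Qed.

Lemma cancel_mono (C : Category) (x y z : C) (e : Hom y z) (s : Hom z y)
    (f g : Hom x y) : s ∘ e = idm y -> e ∘ f = e ∘ g -> f = g.
Proof.
by move=> E /(congr1 (fun h => s ∘ h)); rewrite !compA E !comp1m.
Qed.

Lemma lunit_tens x y : lunit (x ⊗ y) ∘ assoc munit x y = lunit x ⊠ idm y.
Proof.
apply: lunit_faithful.
have KA : (assoc munit munit x ⊠ idm y) ∘ (assoc_inv munit munit x ⊠ idm y)
    = idm (_ ⊗ y) by rewrite -tensM assocKV comp1m tens1.
apply: (cancel_epi (assocKV _ _ _)); apply: (cancel_epi KA).
rewrite -[idm munit in LHS]comp1m tensM -!compA -pentagon.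
rewrite (reassoc1 (triangle _ _)) -tens1 -assoc_nat -triangle.
by rewrite -[idm y in LHS]comp1m tensM (reassoc (assoc_nat _ _ _)).
Qed.

Lemma lunit_braid x : lunit x ∘ braid x munit = runit x.
Proof.
apply: runit_faithful; apply: (cancel_mono (braidK _ _)).
rewrite -(triangle x munit).
rewrite (reassoc (braid_nat _ _)) -lunit_tens -!compA hexagon.
rewrite (reassoc (lunit_nat _)) (reassoc1 (lunit_tens _ _)).
by rewrite -tensM comp1m.
Qed.

Lemma runit_braid x : runit x ∘ braid munit x = lunit x.
Proof. by rewrite -lunit_braid -compA braidK compm1. Qed.

Lemma lrunit : lunit munit = runit munit :> Hom (@munit V ⊗ munit) munit.
Proof.
apply: runit_faithful.
rewrite -lunit_tens -triangle; congr (_ ∘ _).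
by apply: (cancel_mono (lunitK _)); rewrite lunit_nat.
Qed.

Lemma lunit_inv_nat x y (f : Hom x y) :
  lunit_inv y ∘ f = (idm munit ⊠ f) ∘ lunit_inv x.
Proof.
apply: (cancel_mono (lunitK _)).
by rewrite (reassoc (lunit_nat _)) compA !lunitKV comp1m compm1.
Qed.

Lemma runit_inv_nat x y (f : Hom x y) :
  runit_inv y ∘ f = (f ⊠ idm munit) ∘ runit_inv x.
Proof.
apply: (cancel_mono (runitK _)).
by rewrite (reassoc (runit_nat _)) compA !runitKV comp1m compm1.
Qed.

Lemma lrunit_inv : lunit_inv munit = runit_inv munit :> Hom munit (@munit V ⊗ munit).
Proof.
apply: (cancel_mono (lunitK _)).
by rewrite lunitKV lrunit runitKV.
Qed.

Lemma runit_tens x y : (idm x ⊠ runit y) ∘ assoc x y munit = runit (x ⊗ y).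
Proof.
apply: runit_faithful.
apply: (cancel_mono (assocK _ _ _)).
rewrite -[idm munit in LHS]comp1m tensM (reassoc (assoc_nat _ _ _)).
rewrite -(triangle y munit) -[idm x in LHS]comp1m tensM -!compA -pentagon.
by rewrite (reassoc (esym (assoc_nat _ _ _))) tens1 triangle.
Qed.

Lemma assoc_lunit_inv x : assoc _ _ x ∘ (lunit_inv munit ⊠ idm x) =
  idm munit ⊠ lunit_inv x.
Proof.
have K : (idm munit ⊠ lunit_inv x) ∘ (idm munit ⊠ lunit x) = idm (munit ⊗ _)
  by rewrite -tensM lunitK comp1m tens1.
apply: (cancel_mono K); rewrite (reassoc1 (triangle _ _)) -!tensM lunitKV.
by rewrite lrunit_inv runitKV !comp1m.
Qed.

Lemma assoc_runit_inv x y : assoc x y _ ∘ runit_inv (x ⊗ y) = idm x ⊠ runit_inv y.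
Proof.
have K : (idm x ⊠ runit_inv y) ∘ (idm x ⊠ runit y) = idm (x ⊗ _)
  by rewrite -tensM runitK comp1m tens1.
apply: (cancel_mono K); rewrite (reassoc1 (runit_tens _ _)) runitKV.
by rewrite -tensM runitKV comp1m tens1.
Qed.

Lemma hexagon_inv x y z : assoc z y x ∘ ((braid y z ⊠ idm x) ∘
    (assoc_inv y z x ∘ ((idm y ⊠ braid x z) ∘ assoc y x z))) = braid (y ⊗ x) z.
Proof.
apply: (cancel_epi (braidK _ _)).
apply: (cancel_epi (assocKV z y x)).
rewrite -!compA hexagon (reassoc1 (esym (tensM _ _ _ _))) braidK comp1m tens1.
rewrite comp1m (reassoc_id (assocK _ _ _)) -tensM braidK comp1m tens1 compm1.
by rewrite (reassoc_id (braidK _ _)).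
Qed.

Lemma uncurry_inj x y z (f g : Hom x (ihom y z)) :
  ev y z ∘ (f ⊠ idm y) = ev y z ∘ (g ⊠ idm y) -> f = g.
Proof. by move=> E; rewrite -(curry_ev f) E curry_ev. Qed.

Lemma curry_comp w x y z (f : Hom (x ⊗ y) z) (g : Hom w x) :
  curry f ∘ g = curry (f ∘ (g ⊠ idm y)).
Proof.
apply: uncurry_inj; rewrite ev_curry -[idm y in LHS]comp1m tensM.
by rewrite compA ev_curry.
Qed.

End Coherence.

Record VCat (V : SMCC) := {
  vob :> Type;
  vhom : vob -> vob -> V;
  vid : forall a, Hom munit (vhom a a);
  vcomp : forall a b c, Hom (vhom b c ⊗ vhom a b) (vhom a c);
  vcompA : forall a b c d,
    vcomp a b d ∘ (vcomp b c d ⊠ idm (vhom a b)) =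
    vcomp a c d ∘ ((idm (vhom c d) ⊠ vcomp a b c) ∘ assoc _ _ _);
  vcomp1m : forall a b, vcomp a b b ∘ (vid b ⊠ idm (vhom a b)) = lunit _;
  vcompm1 : forall a b, vcomp a a b ∘ (idm (vhom a b) ⊠ vid a) = runit _ }.

Arguments vhom {V v} a b.
Arguments vid {V v} a.
Arguments vcomp {V v} a b c.


Section Vself.
Variable V : SMCC.

Lemma tens_compl (x x' x'' y : V) (g : Hom x' x'') (f : Hom x x') :
  (g ∘ f) ⊠ idm y = (g ⊠ idm y) ∘ (f ⊠ idm y).
Proof. by rewrite -tensM comp1m. Qed.

Lemma tens_compr (x x' x'' y : V) (g : Hom x' x'') (f : Hom x x') :
  idm y ⊠ (g ∘ f) = (idm y ⊠ g) ∘ (idm y ⊠ f).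
Proof. by rewrite -tensM comp1m. Qed.

Definition ihom_comp (x y z : V) : Hom (ihom y z ⊗ ihom x y) (ihom x z) :=
  curry (ev y z ∘ ((idm _ ⊠ ev x y) ∘ assoc _ _ _)).

Lemma ihom_compA (a b c d : V) :
  ihom_comp a b d ∘ (ihom_comp b c d ⊠ idm (ihom a b)) =
  ihom_comp a c d ∘ ((idm (ihom c d) ⊠ ihom_comp a b c) ∘ assoc _ _ _).
Proof.
apply: uncurry_inj; rewrite !tens_compl !(reassoc1 (ev_curry _)) -!compA.
rewrite assoc_nat tens1 (reassoc (tens_swap _ _)).
rewrite (reassoc1 (ev_curry _)) -?compA.
rewrite (reassoc (assoc_nat _ _ _)) (reassoc1 (esym (tens_compr _ _ _))).
rewrite ev_curry !tens_compr -!compA -pentagon -tens1.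
by rewrite (reassoc (assoc_nat _ _ _)).
Qed.

Lemma ihom_comp1m (a b : V) :
  ihom_comp a b b ∘ (curry (lunit b) ⊠ idm (ihom a b)) = lunit _.
Proof.
apply: uncurry_inj; rewrite !tens_compl !(reassoc1 (ev_curry _)) -!compA.
rewrite assoc_nat tens1 (reassoc (tens_swap _ _)).
rewrite (reassoc1 (ev_curry _)).
by rewrite (reassoc (lunit_nat _)) lunit_tens.
Qed.

Lemma ihom_compm1 (a b : V) :
  ihom_comp a a b ∘ (idm (ihom a b) ⊠ curry (lunit a)) = runit _.
Proof.
apply: uncurry_inj; rewrite !tens_compl !(reassoc1 (ev_curry _)) -!compA.
by rewrite assoc_nat (reassoc1 (esym (tens_compr _ _ _))) ev_curry triangle.
Qed.

Definition Vself : VCat V :=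
  {| vob := V;
     vhom x y := ihom x y;
     vid x := curry (lunit x);
     vcomp := ihom_comp;
     vcompA := ihom_compA;
     vcomp1m := ihom_comp1m;
     vcompm1 := ihom_compm1 |}.

End Vself.

Section Opposite.
Variables (V : SMCC) (A : VCat V).

Definition vop_comp (a b c : A) : Hom (vhom c b ⊗ vhom b a) (vhom c a) :=
  vcomp c b a ∘ braid _ _.

Lemma vop_compA (a b c d : A) :
  vop_comp a b d ∘ (vop_comp b c d ⊠ idm (vhom b a)) =
  vop_comp a c d ∘ ((idm (vhom d c) ⊠ vop_comp a b c) ∘ assoc _ _ _).
Proof.
rewrite /vop_comp -!compA !braid_nat.
rewrite (reassoc (braid_nat _ _)).
rewrite -[idm (vhom b a)]comp1m -[idm (vhom d c)]comp1m !tensM -!compA.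
rewrite (reassoc (vcompA _ _ _ _)) -braid_nat -hexagon_inv -!compA.
rewrite -hexagon (reassoc_id (assocK _ _ _)).
by [].
Qed.

Lemma vop_comp1m (a b : A) :
  vop_comp a b b ∘ (vid b ⊠ idm (vhom b a)) = lunit _.
Proof. by rewrite /vop_comp -compA braid_nat compA vcompm1 runit_braid. Qed.

Lemma vop_compm1 (a b : A) :
  vop_comp a a b ∘ (idm (vhom b a) ⊠ vid a) = runit _.
Proof. by rewrite /vop_comp -compA braid_nat compA vcomp1m lunit_braid. Qed.

Definition vop : VCat V :=
  {| vob := A;
     vhom a b := vhom b a;
     vid a := vid a;
     vcomp := vop_comp;
     vcompA := vop_compA;
     vcomp1m := vop_comp1m;
     vcompm1 := vop_compm1 |}.

End Opposite.

Record VFunctor (V : SMCC) (A B : VCat V) := {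
  vfob :> A -> B;
  vfmor : forall a b, Hom (vhom a b) (vhom (vfob a) (vfob b));
  vfmor1 : forall a, vfmor a a ∘ vid a = vid (vfob a);
  vfmorM : forall a b c, vfmor a c ∘ vcomp a b c =
    vcomp (vfob a) (vfob b) (vfob c) ∘ (vfmor b c ⊠ vfmor a b) }.

Arguments vfmor {V A B} v a b.

Section VFunctors.
Variable V : SMCC.
Implicit Types A B C D : VCat V.

Program Definition vfun_comp A B C (G : VFunctor B C) (F : VFunctor A B) :
    VFunctor A C :=
  @Build_VFunctor V A C (fun a => G (F a))
    (fun a b => vfmor G (F a) (F b) ∘ vfmor F a b) _ _.
Next Obligation. by move=> A B C G F a /=; rewrite -compA !vfmor1. Qed.
Next Obligation.
by move=> A B C G F a b c /=; rewrite -compA vfmorM compA vfmorM -compA tensM.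
Qed.

Program Definition vfun_op A B (F : VFunctor A B) : VFunctor (vop A) (vop B) :=
  @Build_VFunctor V (vop A) (vop B) F (fun a b => vfmor F b a) _ _.
Next Obligation. by move=> A B F a /=; rewrite vfmor1. Qed.
Next Obligation.
move=> A B F a b c /=.
by rewrite /vop_comp compA vfmorM -!compA braid_nat.
Qed.

(* The covariant representable A(a,-).  Since [vop A] has hom-objects
   (vop A)(a,x) = A(x,a), the contravariant representable A(-,a) is
   [vrepr (vop A) a]. *)
Program Definition vrepr A (a : A) : VFunctor A (Vself V) :=
  @Build_VFunctor V A (Vself V) (fun x => vhom a x)
    (fun x y => curry (vcomp a x y)) _ _.
Next Obligation. by move=> A a x /=; rewrite curry_comp vcomp1m. Qed.
Next Obligation.
move=> A a x y z /=; apply: uncurry_inj; rewrite !tens_compl.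
rewrite !(reassoc1 (ev_curry _)) vcompA -!compA assoc_nat.
rewrite (reassoc1 (esym (tensM _ _ _ _))) comp1m ev_curry (tens_split (curry _)) -compA.
by rewrite (reassoc1 (ev_curry _)).
Qed.

(* For g : I -> A(a,b), the maps A(x,g) and A(g,x). *)
Definition vpost A (x a b : A) (g : Hom munit (vhom a b)) :
    Hom (vhom x a) (vhom x b) :=
  vcomp x a b ∘ ((g ⊠ idm _) ∘ lunit_inv _).

Definition vpre A (a b x : A) (g : Hom munit (vhom a b)) :
    Hom (vhom b x) (vhom a x) :=
  vcomp a b x ∘ ((idm _ ⊠ g) ∘ runit_inv _).

Definition is_vnat A B (S T : VFunctor A B)
    (tau : forall a, Hom munit (vhom (S a) (T a))) : Prop :=
  forall a b, vpost (S a) (tau b) ∘ vfmor S a b = vpre (T b) (tau a) ∘ vfmor T a b.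

Record VNat A B (S T : VFunctor A B) := {
  vntm :> forall a, Hom munit (vhom (S a) (T a));
  vntm_nat : is_vnat vntm }.

Lemma vnat_ext A B (S T : VFunctor A B) (s t : VNat S T) :
  (forall a, s a = t a) -> s = t.
Proof.
case: s t => [s sP] [t tP] /= E.
have Est : s = t by apply: functional_extensionality_dep.
by rewrite -Est in tP *; congr Build_VNat; apply: proof_irrelevance.
Qed.

Lemma vpost_id A (x a : A) : vpost x (vid a) = idm (vhom x a).
Proof. by rewrite /vpost compA vcomp1m lunitKV. Qed.

Lemma vpre_id A (a x : A) : vpre x (vid a) = idm (vhom a x).
Proof. by rewrite /vpre compA vcompm1 runitKV. Qed.

Lemma vpost_vid A (a b : A) (g : Hom munit (vhom a b)) : vpost a g ∘ vid a = g.
Proof.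
rewrite /vpost -!compA lunit_inv_nat (reassoc (esym (tens_swap _ _))).
by rewrite compA vcompm1 (reassoc (runit_nat _)) lrunit_inv runitKV compm1.
Qed.

Lemma vpost_vpre A (a b c : A) (g : Hom munit (vhom b c)) (f : Hom munit (vhom a b)) :
  vpost a g ∘ f = vpre c f ∘ g.
Proof.
rewrite /vpost /vpre -!compA lunit_inv_nat runit_inv_nat lrunit_inv.
by rewrite (reassoc (tens_swap _ _)).
Qed.

Lemma vpost_comp A (x a b c : A) (g : Hom munit (vhom b c)) (f : Hom munit (vhom a b)) :
  vpost x (vpost a g ∘ f) = vpost x g ∘ vpost x f.
Proof.
rewrite /vpost -!compA lunit_inv_nat !tens_compl -!compA.
rewrite (reassoc (vcompA _ _ _ _)) -!compA.
rewrite !(reassoc (assoc_nat _ _ _)) (reassoc1 (assoc_lunit_inv _)) tens1.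
rewrite (reassoc (lunit_inv_nat (vcomp x a b))).
rewrite (reassoc (lunit_inv_nat (f ⊠ _))) lunit_inv_nat.
by rewrite (reassoc (tens_swap _ _)).
Qed.

Lemma vpost_vop A (x a b : A) (g : Hom munit (vhom b a)) :
  @vpost (vop A) x a b g = @vpre A b a x g.
Proof.
rewrite /vpost /vpre /= /vop_comp -!compA (reassoc (braid_nat _ _)).
congr (_ ∘ (_ ∘ _)); apply: (cancel_mono (runitK _)).
by rewrite runitKV (reassoc1 (runit_braid _)) lunitKV.
Qed.

Lemma vpre_comp A (x a b c : A) (g : Hom munit (vhom b c)) (f : Hom munit (vhom a b)) :
  vpre x (vpost a g ∘ f) = vpre x f ∘ vpre x g.
Proof.
rewrite vpost_vpre -!vpost_vop.
exact: (@vpost_comp (vop A)).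
Qed.

Lemma vpost_vpreC A (a b c d : A) (g : Hom munit (vhom c d)) (f : Hom munit (vhom a b)) :
  vpost a g ∘ vpre c f = vpre d f ∘ vpost b g.
Proof.
rewrite /vpost /vpre -!compA.
rewrite (reassoc (lunit_inv_nat (vcomp a b c))) (reassoc (lunit_inv_nat (_ ⊠ f))).
rewrite lunit_inv_nat -(reassoc (tens_swap _ _)).
rewrite (reassoc (runit_inv_nat (vcomp b c d))) (reassoc (runit_inv_nat (g ⊠ _))).
rewrite (reassoc (tens_swap (vcomp b c d) _)) (reassoc (vcompA _ _ _ _)) -!compA.
rewrite (reassoc (tens_swap (g ⊠ _) _)) -[idm (munit ⊗ _)]tens1.
rewrite !(reassoc (assoc_nat _ _ _)) (reassoc1 (assoc_runit_inv _ _)) tens1.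
by rewrite -(reassoc (tens_swap _ _)).
Qed.

Program Definition vnat_id A B (T : VFunctor A B) : VNat T T :=
  @Build_VNat A B T T (fun a => vid (T a)) _.
Next Obligation.
by move=> A B T a b /=; rewrite vpost_id vpre_id.
Qed.

Program Definition vnat_comp A B (S T U : VFunctor A B)
    (t : VNat T U) (s : VNat S T) : VNat S U :=
  @Build_VNat A B S U (fun a => vpost (S a) (t a) ∘ s a) _.
Next Obligation.
move=> A B S T U t s a b /=; rewrite vpost_comp vpre_comp -[LHS](@compA V) -[RHS](@compA V).
rewrite -(vntm_nat t) (vntm_nat s) [LHS](@compA V) [RHS](@compA V).
by rewrite vpost_vpreC.
Qed.

Program Definition vnat_whisker A B C (S T : VFunctor B C) (t : VNat S T)
    (K : VFunctor A B) : VNat (vfun_comp S K) (vfun_comp T K) :=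
  @Build_VNat A C (vfun_comp S K) (vfun_comp T K) (fun a => t (K a)) _.
Next Obligation.
by move=> A B C S T t K a b /=; rewrite !compA (vntm_nat t).
Qed.

Program Definition VFunCat A B : Category :=
  {| ob := VFunctor A B;
     Hom := @VNat A B;
     idm := @vnat_id A B;
     comp := @vnat_comp A B |}.
Next Obligation.
by move=> A B S T s; apply: vnat_ext => a /=; rewrite vpost_id comp1m.
Qed.
Next Obligation.
by move=> A B S T s; apply: vnat_ext => a /=; rewrite vpost_vid.
Qed.
Next Obligation.
move=> A B R S T U u t s; apply: vnat_ext => a /=.
by rewrite vpost_comp compA.
Qed.

(* The V-natural families X -> B(S a, T a) of Kelly; for X = I these are the
   V-natural transformations. *)
Definition vnatural_family A B (S T : VFunctor A B) (X : V)
    (f : forall a, Hom X (vhom (S a) (T a))) : Prop :=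
  forall a b,
    vcomp (S a) (T a) (T b) ∘ (vfmor T a b ⊠ f a) =
    vcomp (S a) (S b) (T b) ∘ ((f b ⊠ vfmor S a b) ∘ braid (vhom a b) X).

(* [H], with evaluations [e], is the hom-object [A,B](S,T), i.e. the end over a
   of B(S a, T a). *)
Definition is_functor_hom A B (S T : VFunctor A B) (H : V)
    (e : forall a, Hom H (vhom (S a) (T a))) : Prop :=
  vnatural_family e /\
  forall (X : V) (f : forall a, Hom X (vhom (S a) (T a))),
    vnatural_family f -> exists! h : Hom X H, forall a, e a ∘ h = f a.

(* The element I -> [x,y] of the internal hom naming a morphism x -> y. *)
Definition name (x y : V) (f : Hom x y) : Hom munit (ihom x y) :=
  curry (f ∘ lunit x).

(* [c] is the colimit W * F, with unit lam : W => A(F-,c): the induced maps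
   A(c,x) -> [W d, A(F d, x)] exhibit A(c,x) as [D^op,V](W, A(F-,x)). *)
Definition is_colimit D A (W : VFunctor (vop D) (Vself V)) (F : VFunctor D A)
    (c : A) (lam : forall d : D, Hom (W d) (vhom (F d) c)) : Prop :=
  @is_vnat (vop D) (Vself V) W (vfun_comp (vrepr (A := vop A) c) (vfun_op F))
    (fun d => name (lam d)) /\
  forall x : A,
    @is_functor_hom (vop D) (Vself V) W
      (vfun_comp (vrepr (A := vop A) x) (vfun_op F)) (vhom c x)
      (fun d => curry (vcomp (F d) c x ∘ (idm (vhom c x) ⊠ lam d))).

(* Dually, A(x,l) is exhibited as [D,V](W, A(x,F-)). *)
Definition is_limit D A (W : VFunctor D (Vself V)) (F : VFunctor D A)
    (l : A) (lam : forall d : D, Hom (W d) (vhom l (F d))) : Prop :=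
  @is_vnat D (Vself V) W (vfun_comp (vrepr l) F) (fun d => name (lam d)) /\
  forall x : A,
    @is_functor_hom D (Vself V) W (vfun_comp (vrepr x) F) (vhom x l)
      (fun d => curry (vcomp x l (F d) ∘ ((lam d ⊠ idm (vhom x l)) ∘ braid _ _))).

Arguments is_colimit {D A} W F c lam.
Arguments is_limit {D A} W F l lam.

Definition is_small (T : Type) : Prop :=
  exists (S : small_universe) (f : S -> T), bijective f.

Definition is_cocomplete A : Prop :=
  forall (D : VCat V) (W : VFunctor (vop D) (Vself V)) (F : VFunctor D A),
    is_small D -> exists c lam, is_colimit W F c lam.

Definition is_complete A : Prop :=
  forall (D : VCat V) (W : VFunctor D (Vself V)) (F : VFunctor D A),
    is_small D -> exists l lam, is_limit W F l lam.

(* Colimits weighted by W of diagrams in V commute with finite products: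
   whenever P is a pointwise product of a finite family of diagrams F j, with
   projections p j, the comparison maps q j : W * P -> W * F j induced by the
   p j exhibit W * P as the product of the W * F j.  As V is closed, products
   in the underlying category of V are also products in the enriched sense. *)
Definition is_sifted D (W : VFunctor (vop D) (Vself V)) : Prop :=
  forall (J : finType) (F : J -> VFunctor D (Vself V)) (P : VFunctor D (Vself V))
      (p : forall j d, Hom (P d : V) (F j d)),
    (forall j, @is_vnat D (Vself V) P (F j) (fun d => name (p j d))) ->
    (forall d, is_product (fun j => p j d)) ->
  forall (c : V) (lam : forall d, Hom (W d : V) (ihom (P d) c))
      (cF : J -> V) (lamF : forall j d, Hom (W d : V) (ihom (F j d) (cF j))),
    is_colimit W P c lam ->
    (forall j, is_colimit W (F j) (cF j) (lamF j)) ->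
  forall q : forall j, Hom c (cF j),
    (forall j d, @vpost (Vself V) (P d) c (cF j) (name (q j)) ∘ lam d =
       @vpre (Vself V) (P d) (F j d) (cF j) (name (p j d)) ∘ lamF j d) ->
    is_product q.

Definition has_sifted_colimits A : Prop :=
  forall (D : VCat V) (W : VFunctor (vop D) (Vself V)) (F : VFunctor D A),
    is_small D -> is_sifted W -> exists c lam, is_colimit W F c lam.

Definition preserves_sifted_colimits A B (T : VFunctor A B) : Prop :=
  forall (D : VCat V) (W : VFunctor (vop D) (Vself V)) (F : VFunctor D A)
      (c : A) (lam : forall d, Hom (W d : V) (vhom (F d) c)),
    is_small D -> is_sifted W -> is_colimit W F c lam ->
    is_colimit W (vfun_comp T F) (T c) (fun d => vfmor T (F d) c ∘ lam d).

(* phi : G => L K exhibits L as the (pointwise, enriched) left Kan extension of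
   G along K: for each c, L c is the colimit of G weighted by C(K-,c), with unit
   C(K a, c) -> B(L K a, L c) -> B(G a, L c). *)
Definition is_left_kan_extension A B C (K : VFunctor A C) (G : VFunctor A B)
    (L : VFunctor C B) (phi : VNat G (vfun_comp L K)) : Prop :=
  forall c : C,
    is_colimit (vfun_comp (vrepr (A := vop C) c) (vfun_op K)) G (L c)
      (fun a => vpre (L c) (phi a) ∘ vfmor L (K a) c).

Program Definition precomposition A B C (P : VFunctor B C -> Prop)
    (K : VFunctor A B) :
    Functor (@full_subcategory (VFunCat B C) P) (VFunCat A C) :=
  @Build_Functor (@full_subcategory (VFunCat B C) P) (VFunCat A C)
    (fun T => vfun_comp (sval T) K) (fun S T t => vnat_whisker t K) _ _.
Next Obligation. by move=> A B C P K T; apply: vnat_ext. Qed.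
Next Obligation. by move=> A B C P K S T U t s; apply: vnat_ext. Qed.

(* A choice of coproducts KX of X copies of the unit I; the mediating maps are
   data so that K acts on functions without a choice principle. *)
Record FinCopowers := {
  cop : finType -> V;
  copin : forall X : finType, X -> Hom munit (cop X);
  copdesc : forall (X : finType) (y : V), (X -> Hom munit y) -> Hom (cop X) y;
  copdescE : forall (X : finType) (y : V) (f : X -> Hom munit y) x,
    copdesc f ∘ copin x = f x;
  cop_eq : forall (X : finType) (y : V) (f g : Hom (cop X) y),
    (forall x, f ∘ copin x = g ∘ copin x) -> f = g }.

Program Definition copower_functor (K : FinCopowers) : Functor FinSet V :=
  @Build_Functor FinSet V (cop K)
    (fun X Y f => copdesc K (fun x => copin K (f x))) _ _.
Next Obligation.
by move=> K X; apply: cop_eq => x; rewrite copdescE comp1m.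
Qed.
Next Obligation.
by move=> K X Y Z g f; apply: cop_eq => x; rewrite -compA !copdescE.
Qed.

Program Definition SetFin (K : FinCopowers) : VCat V :=
  {| vob := finType;
     vhom X Y := ihom (cop K X) (cop K Y);
     vid X := @vid V (Vself V) (cop K X);
     vcomp X Y Z := @vcomp V (Vself V) (cop K X) (cop K Y) (cop K Z) |}.
Next Obligation. by move=> K a b c d; apply: ihom_compA. Qed.
Next Obligation. by move=> K a b; apply: ihom_comp1m. Qed.
Next Obligation. by move=> K a b; apply: ihom_compm1. Qed.

Program Definition SetFin_incl (K : FinCopowers) : VFunctor (SetFin K) (Vself V) :=
  @Build_VFunctor V (SetFin K) (Vself V) (cop K) (fun X Y => idm _) _ _.
Next Obligation. by move=> K X; rewrite comp1m. Qed.
Next Obligation. by move=> K X Y Z; rewrite comp1m tens1 compm1. Qed.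

(* V is the free completion of finite sets under sifted colimits, via K.  The
   V-categories L range over the same (large) universe as V itself. *)
Definition is_Sind_SetFin (K : FinCopowers) : Prop :=
  forall L : VCat V, has_sifted_colimits L ->
    is_equivalence
      (@precomposition (SetFin K) (Vself V) L
         (@preserves_sifted_colimits (Vself V) L) (SetFin_incl K)).

Definition strongly_finitary (K : FinCopowers) (T : VFunctor (Vself V) (Vself V)) :
    Prop :=
  is_left_kan_extension (K := SetFin_incl K) (G := vfun_comp T (SetFin_incl K))
    (L := T) (vnat_id (vfun_comp T (SetFin_incl K))).

End VFunctors.

(* Main.v *)
From mathcomp Require Import all_boot.
From Stdlib Require Import ClassicalEpsilon.
Require Import Defs.

Set Implicit Arguments.
Unset Strict Implicit.
Unset Printing Implicit Defensive.
Local Open Scope cat_scope.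

(** For an object c of V, the canonical maps [K n, c] ⊗ T (K n) -> T c compare
    the value at c of Lan_K (T K) with T c.  Call c generated when they exhibit
    T c as the coend of [K n, c] ⊗ T (K n) over the finite sets n; T is strongly
    finitary exactly when every object is generated ([strongly_finitaryP]).

    Let c be the colimit of F weighted by a sifted W, with every F d generated.
    Siftedness says that c ↦ [K n, c], which is the n-th power, preserves this
    colimit ([sifted_power]).  Hence the coend of [K n, c] ⊗ T (K n) over n is a
    double coend of W d ⊗ [K n, F d] ⊗ T (K n) over d and n, and, integrating over
    n first, it is the coend of W d ⊗ T (F d) over d ([coend_assoc]).  So
    c is generated if and only if T preserves the colimit c
    ([generated_colimit]).  This gives one implication at once: if all objects
    are generated, then T preserves all sifted colimits.

    Conversely, let T preserve sifted colimits.  Then the full subcategory L of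
    generated objects is closed under sifted colimits in V, and it contains all
    K n by the Yoneda lemma.  As V is the free completion of finite sets under
    sifted colimits, the corestriction of K to L extends to R : V -> L preserving
    sifted colimits.  Both the composite of R with the inclusion of L and the
    identity of V preserve sifted colimits and both restrict to K, so they are
    isomorphic.  Every object c is therefore isomorphic to the generated object
    R c, and generated objects are closed under retracts
    ([generated_retract]).

    Since V is closed, a colimit in V weighted by W is the same thing as the coend
    of W d ⊗ F d, tested only against ordinary morphisms ([colimitP]).  All
    computations are made with such coends. *)

(** * Transposition and coherence in a closed symmetric monoidal category *)

Section Transposition.
Variable V : SMCC.
Implicit Types x y z w X Y : V.

(** Locked so that rewriting with the category laws does not see the composite. *)
Definition uncurry x y z (f : Hom x (ihom y z)) : Hom (x ⊗ y) z :=
  locked (ev y z ∘ (f ⊠ idm y)).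

Lemma uncurryE x y z (f : Hom x (ihom y z)) : ev y z ∘ (f ⊠ idm y) = uncurry f.
Proof. by rewrite /uncurry -lock. Qed.

Lemma uncurryK x y z (f : Hom x (ihom y z)) : curry (uncurry f) = f.
Proof. by rewrite -uncurryE curry_ev. Qed.

Lemma curryK x y z (f : Hom (x ⊗ y) z) : uncurry (curry f) = f.
Proof. by rewrite -uncurryE ev_curry. Qed.

Lemma uncurry_injective x y z (f g : Hom x (ihom y z)) : uncurry f = uncurry g -> f = g.
Proof. by move=> E; rewrite -(uncurryK f) E uncurryK. Qed.

Lemma uncurry_comp w x y z (f : Hom x (ihom y z)) (g : Hom w x) :
  uncurry (f ∘ g) = uncurry f ∘ (g ⊠ idm y).
Proof. by rewrite -!uncurryE tens_compl compA. Qed.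

Lemma ev_uncurry y z : ev y z = uncurry (idm (ihom y z)).
Proof. by rewrite -uncurryE tens1 compm1. Qed.

Definition lcurry x y z (f : Hom (x ⊗ y) z) : Hom y (ihom x z) := curry (f ∘ braid y x).

Definition luncurry x y z (f : Hom y (ihom x z)) : Hom (x ⊗ y) z := uncurry f ∘ braid x y.

Lemma lcurryK x y z (f : Hom (x ⊗ y) z) : luncurry (lcurry f) = f.
Proof. by rewrite /luncurry curryK -compA braidK compm1. Qed.

Lemma lcurry_comp w x y z (f : Hom (x ⊗ y) z) (g : Hom w y) :
  lcurry f ∘ g = lcurry (f ∘ (idm x ⊠ g)).
Proof. by rewrite /lcurry curry_comp -!compA braid_nat. Qed.

Lemma luncurry_comp w x y z (f : Hom y (ihom x z)) (g : Hom w y) :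
  luncurry (f ∘ g) = luncurry f ∘ (idm x ⊠ g).
Proof. by rewrite /luncurry uncurry_comp -!compA braid_nat. Qed.

Lemma uncurry_ihom_comp (x y z w w' : V) (g : Hom w (ihom y z)) (f : Hom w' (ihom x y)) :
  uncurry (ihom_comp x y z ∘ (g ⊠ f)) = uncurry g ∘ ((idm w ⊠ uncurry f) ∘ assoc _ _ _).
Proof.
rewrite uncurry_comp /ihom_comp curryK -!compA assoc_nat.
rewrite (reassoc1 (esym (tensM _ _ _ _))) comp1m uncurryE.
by rewrite (tens_split g) -!compA (reassoc1 (uncurryE _)).
Qed.

Lemma assoc_inv_nat x x' y y' z z' (f : Hom x x') (g : Hom y y') (h : Hom z z') :
  assoc_inv x' y' z' ∘ (f ⊠ (g ⊠ h)) = ((f ⊠ g) ⊠ h) ∘ assoc_inv x y z.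
Proof.
apply: (cancel_mono (assocK _ _ _)).
by rewrite (reassoc_id (assocKV _ _ _)) (reassoc (assoc_nat _ _ _)) assocKV compm1.
Qed.

Lemma pentagon_inv w x y z :
  (assoc_inv w x y ⊠ idm z) ∘ (assoc_inv w (x ⊗ y) z ∘ (idm w ⊠ assoc_inv x y z)) =
  assoc_inv (w ⊗ x) y z ∘ assoc_inv w x (y ⊗ z).
Proof.
have E : (assoc w x (y ⊗ z) ∘ assoc (w ⊗ x) y z) ∘
   ((assoc_inv w x y ⊠ idm z) ∘ (assoc_inv w (x ⊗ y) z ∘ (idm w ⊠ assoc_inv x y z)))
   = idm _.
  rewrite pentagon -!compA (reassoc1 (esym (tens_compl _ _ _))) assocKV tens1 comp1m.
  by rewrite (reassoc_id (assocKV _ _ _)) -tens_compr assocKV tens1.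
move/(congr1 (fun h => (assoc_inv (w ⊗ x) y z ∘ assoc_inv w x (y ⊗ z)) ∘ h)): E.
rewrite compm1 => <-.
by rewrite -!compA (reassoc_id (assocK _ _ _)) (reassoc_id (assocK _ _ _)).
Qed.

Lemma lunit_inv_tens x y : assoc munit x y ∘ (lunit_inv x ⊠ idm y) = lunit_inv (x ⊗ y).
Proof.
apply: (cancel_mono (lunitK _)); rewrite (reassoc1 (lunit_tens _ _)).
by rewrite -tens_compl !lunitKV tens1.
Qed.

Lemma vpost_vcomp (A : VCat V) (x y a b : A) (g : Hom munit (vhom a b)) :
  vpost x g ∘ vcomp x y a = vcomp x y b ∘ (vpost y g ⊠ idm (vhom x y)).
Proof.
rewrite /vpost -!compA lunit_inv_nat -lunit_inv_tens.
rewrite -(reassoc (tens_swap _ _)).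
rewrite -tens1 -(reassoc (assoc_nat _ _ _)).
rewrite !tens_compl. by rewrite (reassoc (vcompA _ _ _ _)) -!compA.
Qed.

End Transposition.

(** * Coends over families of actions *)

Section Coends.
Variable V : SMCC.
Implicit Types c x y z X Y : V.

Section Balanced.
(** M is acted on by H from the right and N from the left; their coend is the
    tensor product of M and N over H. *)
Variables (I : Type) (H : I -> I -> V) (M N : I -> V).
Variable r : forall a b, Hom (M b ⊗ H a b) (M a).
Variable l : forall a b, Hom (H a b ⊗ N a) (N b).

Definition balanced z (g : forall i, Hom (M i ⊗ N i) z) : Prop :=
  forall a b, g a ∘ (r a b ⊠ idm (N a)) =
    g b ∘ ((idm (M b) ⊠ l a b) ∘ assoc _ _ _).

(** The universal property is split by target because a colimit in a full
    subcategory provides it only for targets in that subcategory. *)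
Definition universal_at c (lam : forall i, Hom (M i ⊗ N i) c) z : Prop :=
  forall g : forall i, Hom (M i ⊗ N i) z, balanced g ->
    exists! h : Hom c z, forall i, h ∘ lam i = g i.

Definition is_coend c (lam : forall i, Hom (M i ⊗ N i) c) : Prop :=
  balanced lam /\ forall z, universal_at lam z.

Lemma balanced_comp y z (g : forall i, Hom (M i ⊗ N i) y) (h : Hom y z) :
  balanced g -> balanced (fun i => h ∘ g i).
Proof. by move=> gP a b; rewrite -!compA gP. Qed.

Lemma universal_at_inj c (lam : forall i, Hom (M i ⊗ N i) c) z (h k : Hom c z) :
  balanced lam -> universal_at lam z ->
  (forall i, h ∘ lam i = k ∘ lam i) -> h = k.
Proof.
move=> lamP /(_ _ (balanced_comp k lamP)) [j [_ U]] E.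
by rewrite -(U h E) -(U k).
Qed.

Definition tensl_act X (a b : I) : Hom ((X ⊗ M b) ⊗ H a b) (X ⊗ M a) :=
  (idm X ⊠ r a b) ∘ assoc _ _ _.

Definition tensr_act Y (a b : I) : Hom (H a b ⊗ (N a ⊗ Y)) (N b ⊗ Y) :=
  (l a b ⊠ idm Y) ∘ assoc_inv _ _ _.

End Balanced.

Lemma coend_ext (I : Type) (H : I -> I -> V) (M N : I -> V)
    (r r' : forall a b, Hom (M b ⊗ H a b) (M a))
    (l l' : forall a b, Hom (H a b ⊗ N a) (N b)) c
    (lam lam' : forall i, Hom (M i ⊗ N i) c) :
  (forall a b, r a b = r' a b) -> (forall a b, l a b = l' a b) ->
  (forall i, lam i = lam' i) -> is_coend r l lam -> is_coend r' l' lam'.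
Proof.
move=> Er El Elam [lamP lamU].
have bal z g : balanced r l g <-> balanced (z := z) r' l' g.
  by split=> gP a b; [rewrite -Er -El gP | rewrite Er El gP].
split=> [|z g /bal/lamU [h [hE hU]]].
  by apply/bal => a b; rewrite -!Elam lamP.
exists h; split=> [i|k kE]; first by rewrite -Elam.
by apply: hU => i; rewrite Elam.
Qed.

Lemma coend_iso (I : Type) (H : I -> I -> V) (M N : I -> V)
    (r : forall a b, Hom (M b ⊗ H a b) (M a))
    (l : forall a b, Hom (H a b ⊗ N a) (N b)) c c'
    (lam : forall i, Hom (M i ⊗ N i) c) (f : Hom c c') :
  is_iso f -> is_coend r l lam -> is_coend r l (fun i => f ∘ lam i).
Proof.
move=> [g [gf fg]] [lamP lamU]; split; first exact: balanced_comp.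
move=> z b /lamU [h [hE hU]]; exists (h ∘ g); split=> [i|k kE].
  by rewrite -compA (reassoc_id gf).
rewrite (hU (k ∘ f)) ?(=^~ compA, fg, compm1) // => i.
by rewrite -compA kE.
Qed.

Section CoendTensor.
Variables (I : Type) (H : I -> I -> V) (M N : I -> V).
Variable r : forall a b, Hom (M b ⊗ H a b) (M a).
Variable l : forall a b, Hom (H a b ⊗ N a) (N b).
Variables (c : V) (lam : forall i, Hom (M i ⊗ N i) c).

(** - ⊗ Y is a left adjoint: balanced maps M i ⊗ (N i ⊗ Y) -> z transpose to
    balanced maps M i ⊗ N i -> [Y, z]. *)
Lemma coend_tensr Y : is_coend r l lam ->
  is_coend r (tensr_act l Y) (fun i => (lam i ⊠ idm Y) ∘ assoc_inv _ _ _).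
Proof.
(* L and R turn the two sides of the balancing equation of the transpose of g
   into those of the balancing equation of g. *)
have shuffle z (g : forall i, Hom (M i ⊗ (N i ⊗ Y)) z) :
    balanced r (tensr_act l Y) g <->
    balanced r l (fun i => curry (g i ∘ assoc _ _ _)).
  have L a b : curry (g a ∘ assoc _ _ _) ∘ (r a b ⊠ idm (N a)) =
     curry ((g a ∘ (r a b ⊠ idm (N a ⊗ Y))) ∘ assoc _ _ _).
    by rewrite curry_comp -!compA assoc_nat tens1.
  have R a b : curry (g b ∘ assoc _ _ _) ∘ ((idm (M b) ⊠ l a b) ∘ assoc _ _ _) =
     curry ((g b ∘ ((idm (M b) ⊠ tensr_act l Y a b) ∘ assoc _ _ _)) ∘ assoc _ _ _).
    rewrite curry_comp; congr curry; rewrite tens_compl -!compA.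
    congr (_ ∘ _); rewrite pentagon (reassoc (assoc_nat _ _ _)).
    rewrite /tensr_act tens_compr -!compA.
    by rewrite (reassoc1 (esym (tens_compr _ (assoc_inv _ _ _) _))) assocK tens1 comp1m.
  split=> gP a b; first by rewrite L R gP.
  have := gP a b; rewrite L R => /(congr1 (fun h => uncurry h ∘ assoc_inv _ _ _)).
  by rewrite !curryK -!compA !assocKV !compm1.
move=> [lamP lamU]; split.
  have E i : curry ((lam i ⊠ idm Y) ∘ assoc_inv _ _ _ ∘ assoc _ _ _) = curry (lam i ⊠ idm Y).
    by rewrite -compA assocK compm1.
  apply/shuffle => a b; rewrite !E !curry_comp; congr curry.
  by rewrite -!tens_compl lamP.
move=> z g /shuffle /lamU [h [hE hU]].
exists (uncurry h); split=> [i|k kE].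
  by rewrite compA -uncurry_comp hE curryK -compA assocKV compm1.
rewrite -[RHS]curryK; congr uncurry; apply: hU => i.
by rewrite curry_comp -kE -!compA assocK compm1.
Qed.

(** The same argument for X ⊗ -, whose right adjoint comes from the symmetry. *)
Lemma coend_tensl X : is_coend r l lam ->
  is_coend (tensl_act r X) l (fun i => (idm X ⊠ lam i) ∘ assoc _ _ _).
Proof.
have shuffle z (g : forall i, Hom ((X ⊗ M i) ⊗ N i) z) :
    balanced (tensl_act r X) l g <->
    balanced r l (fun i => lcurry (g i ∘ assoc_inv _ _ _)).
  have L a b : lcurry (g a ∘ assoc_inv _ _ _) ∘ (r a b ⊠ idm (N a)) =
     lcurry ((g a ∘ (tensl_act r X a b ⊠ idm (N a))) ∘
       ((assoc_inv _ _ _ ⊠ idm _) ∘ assoc_inv _ _ _)).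
    rewrite lcurry_comp -!compA assoc_inv_nat /tensl_act tens_compl -!compA.
    by rewrite (reassoc1 (esym (tens_compl _ (assoc _ _ _) _))) assocKV tens1 comp1m.
  have R a b : lcurry (g b ∘ assoc_inv _ _ _) ∘ ((idm (M b) ⊠ l a b) ∘ assoc _ _ _) =
     lcurry ((g b ∘ ((idm (X ⊗ M b) ⊠ l a b) ∘ assoc _ _ _)) ∘
       ((assoc_inv _ _ _ ⊠ idm _) ∘ assoc_inv _ _ _)).
    rewrite lcurry_comp; congr lcurry; rewrite tens_compr -!compA.
    congr (_ ∘ _); rewrite (reassoc (assoc_inv_nat _ _ _)) tens1; congr (_ ∘ _).
    have K : (idm X ⊠ assoc_inv (M b) (H a b) (N a)) ∘ (idm X ⊠ assoc _ _ _) = idm _.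
      by rewrite -tens_compr assocK tens1.
    apply: (cancel_epi K); rewrite -!compA pentagon_inv (reassoc_id (assocKV _ _ _)).
    by rewrite -tens_compr assocKV tens1 compm1.
  split=> gP a b; first by rewrite L R gP.
  have := gP a b; rewrite L R => /(congr1 (fun h => luncurry h ∘ (assoc _ _ _ ∘
    (assoc _ _ _ ⊠ idm _)))).
  rewrite !lcurryK -!compA !(reassoc_id (assocK _ _ _)) -!tens_compl !assocK.
  by rewrite tens1 !compm1.
move=> [lamP lamU]; split.
  have E i : lcurry ((idm X ⊠ lam i) ∘ assoc _ _ _ ∘ assoc_inv _ _ _) = lcurry (idm X ⊠ lam i).
    by rewrite -compA assocKV compm1.
  apply/shuffle => a b; rewrite !E !lcurry_comp; congr lcurry.
  by rewrite -!tens_compr lamP.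
move=> z g /shuffle /lamU [h [hE hU]].
exists (luncurry h); split=> [i|k kE].
  by rewrite compA -luncurry_comp hE lcurryK -compA assocK compm1.
rewrite -[RHS]lcurryK; congr luncurry; apply: hU => i.
by rewrite lcurry_comp -kE -!compA assocKV compm1.
Qed.

Lemma coend_tensr_inj z Y (f g : Hom (c ⊗ Y) z) : is_coend r l lam ->
  (forall i, f ∘ (lam i ⊠ idm Y) = g ∘ (lam i ⊠ idm Y)) -> f = g.
Proof.
move=> lamP E; have [lP lU] := coend_tensr Y lamP.
by apply: (universal_at_inj lP (lU z)) => i; rewrite !compA E.
Qed.

Lemma coend_tensl_inj z X (f g : Hom (X ⊗ c) z) : is_coend r l lam ->
  (forall i, f ∘ (idm X ⊠ lam i) = g ∘ (idm X ⊠ lam i)) -> f = g.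
Proof.
move=> lamP E; have [lP lU] := coend_tensl X lamP.
by apply: (universal_at_inj lP (lU z)) => i; rewrite !compA E.
Qed.

End CoendTensor.
End Coends.

(** * Associativity of iterated coends *)

Section Transfer.
Variable C : Category.

(** Two kinds of cocones, [GA] and [GB], that correspond bijectively and
    compatibly with postcomposition have the same universal ones. *)
Lemma universal_transfer (I J : Type) (A : J -> C) (B : I -> C)
    (GA : forall z, (forall j, Hom (A j) z) -> Prop)
    (GB : forall z, (forall i, Hom (B i) z) -> Prop)
    (R : forall z, (forall j, Hom (A j) z) -> (forall i, Hom (B i) z) -> Prop)
    (R_comp : forall y z (h : Hom y z) a b,
      R _ a b -> R _ (fun j => h ∘ a j) (fun i => h ∘ b i))
    (R_good : forall z a b, R z a b -> (GA _ a <-> GB _ b))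
    (R_ex : forall z b, GB z b -> exists a, R z a b)
    (R_inj_l : forall z a a' b b', R z a b -> R z a' b' ->
      (forall i, b i = b' i) -> forall j, a j = a' j)
    (R_inj_r : forall z a a' b b', R z a b -> R z a' b' ->
      (forall j, a j = a' j) -> forall i, b i = b' i)
    (t : C) (alpha : forall j, Hom (A j) t) (beta : forall i, Hom (B i) t) :
  R t alpha beta ->
  (GA _ alpha /\ forall z a, GA z a -> exists! h, forall j, h ∘ alpha j = a j) ->
  (GB _ beta /\ forall z b, GB z b -> exists! h, forall i, h ∘ beta i = b i).
Proof.
move=> Rt [alphaP alphaU]; split; first by apply/(R_good _ _ _ Rt).
move=> z b bP; have [a Rab] := R_ex _ _ bP.
have [h [hE hU]] := alphaU _ _ ((R_good _ _ _ Rab).2 bP).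
exists h; split; first exact: (R_inj_r _ _ _ _ _ (R_comp _ _ h _ _ Rt) Rab).
by move=> k kE; apply: hU; apply: (R_inj_l _ _ _ _ _ (R_comp _ _ k _ _ Rt) Rab).
Qed.

End Transfer.

Section Fubini.
Variable V : SMCC.
(** P is a bimodule; C n and Q i are the coends of M and P n over I, and of
    P - i and N over J; s and u are the actions that C and Q inherit from P. *)
Variables (I J : Type) (H : I -> I -> V) (G : J -> J -> V).
Variables (M : I -> V) (P : J -> I -> V) (N : J -> V) (C : J -> V) (Q : I -> V).
Variable r : forall a b, Hom (M b ⊗ H a b) (M a).
Variable p : forall n a b, Hom (H a b ⊗ P n a) (P n b).
Variable q : forall i n m, Hom (P m i ⊗ G n m) (P n i).
Variable l : forall n m, Hom (G n m ⊗ N n) (N m).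
Variable s : forall n m, Hom (C m ⊗ G n m) (C n).
Variable u : forall a b, Hom (H a b ⊗ Q a) (Q b).
Variable mu : forall n i, Hom (M i ⊗ P n i) (C n).
Variable nu : forall i n, Hom (P n i ⊗ N n) (Q i).
Hypothesis muP : forall n, is_coend r (p n) (mu n).
Hypothesis nuP : forall i, is_coend (q i) l (nu i).
Hypothesis mu_lin : forall i n m,
  mu n i ∘ tensl_act (q i) (M i) n m = s n m ∘ (mu m i ⊠ idm (G n m)).
Hypothesis nu_lin : forall n a b,
  nu b n ∘ tensr_act (p n) (N n) a b = u a b ∘ (idm (H a b) ⊠ nu a n).

(** The maps mu m i, tensored with G n m and N n, are jointly epimorphic, so the
    balancing equation of a can be tested after precomposition with them. *)
Lemma balanced_mu z (a : forall n, Hom (C n ⊗ N n) z) :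
  balanced s l a <->
  forall i, balanced (tensl_act (q i) (M i)) l (fun n => a n ∘ (mu n i ⊠ idm (N n))).
Proof.
have L i n m : (a n ∘ (mu n i ⊠ idm _)) ∘ (tensl_act (q i) (M i) n m ⊠ idm (N n)) =
    (a n ∘ (s n m ⊠ idm (N n))) ∘ ((mu m i ⊠ idm _) ⊠ idm _).
  by rewrite -!compA -!tens_compl mu_lin.
have R i n m : (a m ∘ (mu m i ⊠ idm _)) ∘ ((idm (M i ⊗ P m i) ⊠ l n m) ∘ assoc _ _ _) =
    (a m ∘ ((idm (C m) ⊠ l n m) ∘ assoc _ _ _)) ∘ ((mu m i ⊠ idm _) ⊠ idm _).
  by rewrite -!compA assoc_nat tens1 -(reassoc (tens_swap _ _)).
split=> aP; first by move=> i n m; rewrite L R aP.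
move=> n m; apply: (coend_tensr_inj (coend_tensr _ (muP m))) => i.
rewrite !tens_compl !compA; congr (_ ∘ _).
by have := aP i n m; rewrite L R !compA.
Qed.

Lemma balanced_nu z (b : forall i, Hom (M i ⊗ Q i) z) :
  balanced r u b <->
  forall n, balanced r (tensr_act (p n) (N n)) (fun i => b i ∘ (idm (M i) ⊠ nu i n)).
Proof.
have L n a a' : (b a ∘ (idm _ ⊠ nu a n)) ∘ (r a a' ⊠ idm (P n a ⊗ N n)) =
    (b a ∘ (r a a' ⊠ idm _)) ∘ (idm (_ ⊗ _) ⊠ nu a n).
  by rewrite -!compA tens_swap.
have R n a a' : (b a' ∘ (idm _ ⊠ nu a' n)) ∘
      ((idm _ ⊠ tensr_act (p n) (N n) a a') ∘ assoc _ _ _) =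
    (b a' ∘ ((idm (M a') ⊠ u a a') ∘ assoc _ _ _)) ∘ (idm (_ ⊗ _) ⊠ nu a n).
  rewrite -!compA (reassoc1 (esym (tens_compr _ (nu a' n) _))) nu_lin tens_compr -!compA.
  by rewrite -assoc_nat tens1.
split=> bP; first by move=> n a a'; rewrite L R bP.
move=> a a'; apply: (coend_tensl_inj (nuP a)) => n.
by have := bP n a a'; rewrite L R.
Qed.

(** The isomorphism (M ⊗ P) ⊗ N = M ⊗ (P ⊗ N) of tensor products over I and J:
    balanced families on either side correspond to families of maps
    (M i ⊗ P n i) ⊗ N n -> z that are balanced in i and in n. *)
Lemma coend_assoc t (alpha : forall n, Hom (C n ⊗ N n) t)
    (beta : forall i, Hom (M i ⊗ Q i) t) :
  (forall i n, alpha n ∘ (mu n i ⊠ idm (N n)) =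
     beta i ∘ ((idm (M i) ⊠ nu i n) ∘ assoc _ _ _)) ->
  is_coend s l alpha <-> is_coend r u beta.
Proof.
move=> Rt.
(* [R a b]: the two families induce the same maps (M i ⊗ P n i) ⊗ N n -> z. *)
pose R z (a : forall n, Hom (C n ⊗ N n) z) (b : forall i, Hom (M i ⊗ Q i) z) :=
  forall i n, a n ∘ (mu n i ⊠ idm (N n)) = b i ∘ ((idm (M i) ⊠ nu i n) ∘ assoc _ _ _).
have R' z a b : R z a b -> forall i n,
    a n ∘ ((mu n i ⊠ idm (N n)) ∘ assoc_inv _ _ _) = b i ∘ (idm (M i) ⊠ nu i n).
  by move=> Rab i n; rewrite compA Rab -!compA assocKV compm1.
have R_comp y z (h : Hom y z) a b : R _ a b -> R _ (fun j => h ∘ a j) (fun i => h ∘ b i).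
  by move=> Rab i n; rewrite -!compA; congr (_ ∘ _); apply: Rab.
have R_bal_a z a b : R z a b -> balanced r u b -> balanced s l a.
  move=> Rab bP; apply/balanced_mu => i n m; rewrite !Rab.
  exact: (balanced_comp (b i) (coend_tensl (M i) (nuP i)).1 n m).
have R_bal_b z a b : R z a b -> balanced s l a -> balanced r u b.
  move=> Rab bP; apply/balanced_nu => n i j; rewrite -!(R' _ _ _ Rab).
  exact: (balanced_comp (a n) (coend_tensr (N n) (muP n)).1 i j).
have R_inj_a z a a' b b' : R z a b -> R z a' b' ->
    (forall i, b i = b' i) -> forall n, a n = a' n.
  by move=> Rab Rab' E n; apply: (coend_tensr_inj (muP n)) => i; rewrite Rab Rab' E.
have R_inj_b z a a' b b' : R z a b -> R z a' b' ->
    (forall n, a n = a' n) -> forall i, b i = b' i.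
  move=> Rab Rab' E i; apply: (coend_tensl_inj (nuP i)) => n.
  by rewrite -(R' _ _ _ Rab) -(R' _ _ _ Rab') E.
(* The components of the partner family are each determined uniquely, but
   assembling them over all indices is a choice. *)
have R_ex_a z b : balanced r u b -> exists a, R z a b.
  move=> /balanced_nu bP.
  have /(_ _)/constructive_indefinite_description a n :=
    (coend_tensr (N n) (muP n)).2 _ _ (bP n).
  exists (fun n => sval (a n)) => i n; case: (a n) => /= h [hE _].
  by rewrite compA -hE -!compA assocK compm1.
have R_ex_b z a : balanced s l a -> exists b, R z a b.
  move=> /balanced_mu aP.
  have /(_ _)/constructive_indefinite_description b i :=
    (coend_tensl (M i) (nuP i)).2 _ _ (aP i).
  by exists (fun i => sval (b i)) => i n; case: (b i) => /= h [hE _].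
split=> cP.
  apply: (universal_transfer (R := R) R_comp _ R_ex_a R_inj_a R_inj_b Rt cP).
  by move=> z a b Rab; split; [apply: R_bal_b Rab | apply: R_bal_a Rab].
apply: (universal_transfer (R := fun z b a => R z a b) _ _ R_ex_b _ _ Rt cP).
- by move=> y z h b a; apply: R_comp.
- by move=> z b a Rab; split; [apply: R_bal_a Rab | apply: R_bal_b Rab].
- by move=> z b b' a a' Rab Rab'; apply: R_inj_b Rab Rab'.
- by move=> z b b' a a' Rab Rab'; apply: R_inj_a Rab Rab'.
Qed.

End Fubini.

(** * Weighted colimits in V as coends *)

Section Colimits.
Variable V : SMCC.
Implicit Types x y z X Y : V.

Lemma vpost_self (x y z : V) (g : Hom y z) :
  @vpost V (Vself V) x y z (name g) = curry (g ∘ ev x y).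
Proof.
apply: uncurry_injective; rewrite curryK /vpost compA uncurry_comp /=.
rewrite uncurry_ihom_comp /name curryK -!compA.
rewrite (reassoc (lunit_nat _)) (reassoc1 (lunit_tens _ _)).
by rewrite -tens_compl lunitKV tens1 compm1 ev_uncurry.
Qed.

Lemma vpre_self (x y z : V) (f : Hom x y) :
  @vpre V (Vself V) x y z (name f) = curry (ev y z ∘ (idm _ ⊠ f)).
Proof.
apply: uncurry_injective; rewrite curryK /vpre compA uncurry_comp /=.
rewrite uncurry_ihom_comp /name curryK tens_compr -!compA (reassoc1 (triangle _ _)).
by rewrite -tens_compl runitKV !tens1 ?compm1 ev_uncurry.
Qed.

Definition lact A (F : VFunctor A (Vself V)) (a b : A) : Hom (vhom a b ⊗ (F a : V)) (F b) :=
  uncurry (vfmor F a b).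

Definition ract D (W : VFunctor (vop D) (Vself V)) (a b : D) :
    Hom ((W b : V) ⊗ vhom a b) (W a) :=
  lact W b a ∘ braid _ _.

Lemma is_vnat_self A (S T : VFunctor A (Vself V)) (t : forall a, Hom (S a : V) (T a)) :
  is_vnat (S := S) (T := T) (fun a => name (t a)) <->
  forall a b, t b ∘ lact S a b = lact T a b ∘ (idm _ ⊠ t a).
Proof.
have L a b : uncurry (@vpost V (Vself V) (S a) (S b) (T b) (name (t b)) ∘ vfmor S a b)
    = t b ∘ lact S a b.
  by rewrite vpost_self uncurry_comp curryK -!compA uncurryE.
have R a b : uncurry (@vpre V (Vself V) (S a) (T a) (T b) (name (t a)) ∘ vfmor T a b)
    = lact T a b ∘ (idm _ ⊠ t a).
  by rewrite vpre_self uncurry_comp curryK -!compA tens_swap (reassoc1 (uncurryE _)).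
split=> tP a b; first by rewrite -L -R tP.
by apply: uncurry_injective; rewrite L R.
Qed.

Lemma lact_contra D (F : VFunctor D (Vself V)) (c : V) (a b : D) :
  lact (vfun_comp (vrepr (A := vop (Vself V)) c) (vfun_op F)) b a =
  ihom_comp (F a) (F b) c ∘ ((idm _ ⊠ vfmor F a b) ∘ braid _ _).
Proof.
rewrite /lact /= uncurry_comp curryK /vop_comp /= -!compA; congr (_ ∘ _).
exact: braid_nat.
Qed.

Lemma colimit_unit_balanced D (W : VFunctor (vop D) (Vself V)) (F : VFunctor D (Vself V)) (c : V)
    (lam : forall d : D, Hom (W d : V) (ihom (F d) c)) :
  @is_vnat _ (vop D) (Vself V) W (vfun_comp (vrepr (A := vop (Vself V)) c) (vfun_op F))
    (fun d => name (lam d)) <->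
  balanced (ract W) (lact F) (fun d => uncurry (lam d)).
Proof.
apply: (iff_trans (is_vnat_self _)).
have E (a b : D) : uncurry (lact (vfun_comp (vrepr (A := vop (Vself V)) c) (vfun_op F)) b a ∘
    (idm _ ⊠ lam b)) =
    uncurry (lam b) ∘ ((idm _ ⊠ lact F a b) ∘ (assoc _ _ _ ∘ (braid _ _ ⊠ idm _))).
  rewrite lact_contra -!compA braid_nat.
  rewrite (reassoc1 (esym (tensM (idm (ihom (F b) c)) (lam b) (vfmor F a b) (idm _)))).
  rewrite comp1m compm1.
  by rewrite (compA (ihom_comp _ _ _)) uncurry_comp uncurry_ihom_comp -!compA.
have K (a b : D) : (braid (vhom a b) (W b : V) ⊠ idm (F a : V)) ∘ (braid _ _ ⊠ idm _) = idm _.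
  by rewrite -tens_compl braidK tens1.
split=> lamP a b.
  apply: (cancel_epi (K a b)); rewrite -!compA -E -(lamP b a) uncurry_comp.
  by rewrite -tens_compl /ract -compA braidK compm1.
apply: uncurry_injective; rewrite E uncurry_comp.
have := congr1 (fun h => h ∘ (braid _ _ ⊠ idm _)) (lamP b a).
by rewrite -!compA -!tens_compl -!compA braidK compm1 => ->.
Qed.

Lemma vnatural_family_self A (S T : VFunctor A (Vself V)) X
    (f : forall a, Hom X (ihom (S a) (T a))) :
  vnatural_family (S := S) (T := T) f <->
  forall a b, lact T a b ∘ ((idm _ ⊠ uncurry (f a)) ∘ assoc _ _ _) =
    uncurry (f b) ∘ ((idm X ⊠ lact S a b) ∘ (assoc _ _ _ ∘ (braid _ _ ⊠ idm _))).
Proof.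
have L a b : uncurry (ihom_comp (S a) (T a) (T b) ∘ (vfmor T a b ⊠ f a)) =
    lact T a b ∘ ((idm _ ⊠ uncurry (f a)) ∘ assoc _ _ _).
  by rewrite uncurry_ihom_comp.
have R a b : uncurry (ihom_comp (S a) (S b) (T b) ∘ ((f b ⊠ vfmor S a b) ∘ braid (vhom a b) X)) =
    uncurry (f b) ∘ ((idm X ⊠ lact S a b) ∘ (assoc _ _ _ ∘ (braid _ _ ⊠ idm _))).
  by rewrite (compA (ihom_comp _ _ _)) uncurry_comp uncurry_ihom_comp -!compA.
split=> fP a b; first by rewrite -L -R; congr uncurry; apply: fP.
by apply: uncurry_injective; rewrite L R.
Qed.

(** Transposing twice turns a family X -> [W d, [F d, x]] into a family
    (X ⊗ W d) ⊗ F d -> x, and V-naturality into the balancing equation; the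
    hexagon accounts for the reordering of the factors. *)
Lemma vnatural_family_balanced D (W : VFunctor (vop D) (Vself V)) (F : VFunctor D (Vself V)) x X
    (f : forall d : D, Hom X (ihom (W d) (ihom (F d) x))) :
  @vnatural_family _ (vop D) (Vself V) W (vfun_comp (vrepr (A := vop (Vself V)) x) (vfun_op F)) X f <->
  balanced (tensl_act (ract W) X) (lact F) (fun d => uncurry (uncurry (f d))).
Proof.
apply: (iff_trans (vnatural_family_self _)).
have L (a b : D) : uncurry (lact (vfun_comp (vrepr (A := vop (Vself V)) x) (vfun_op F)) b a ∘
      ((idm _ ⊠ uncurry (f b)) ∘ assoc _ _ _)) =
    (uncurry (uncurry (f b)) ∘ ((idm _ ⊠ lact F a b) ∘ assoc _ _ _)) ∘
      ((braid _ _ ∘ assoc _ _ _) ⊠ idm _).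
  rewrite lact_contra -!compA (reassoc (braid_nat _ _)).
  rewrite (reassoc1 (esym (tensM _ _ _ _))) comp1m compm1.
  by rewrite (compA (ihom_comp _ _ _)) uncurry_comp uncurry_ihom_comp -!compA.
have R (a b : D) : uncurry (uncurry (f a) ∘
      ((idm X ⊠ lact W b a) ∘ (assoc _ _ _ ∘ (braid _ _ ⊠ idm _)))) =
    (uncurry (uncurry (f a)) ∘ (tensl_act (ract W) X a b ⊠ idm _)) ∘
      ((braid _ _ ∘ assoc _ _ _) ⊠ idm _).
  rewrite uncurry_comp -!compA -!tens_compl /tensl_act /ract; congr (_ ∘ (_ ⊠ _)).
  rewrite -!compA hexagon tens_compr -!compA.
  by rewrite (reassoc1 (esym (tens_compr _ (braid _ _) _))) braidK tens1 comp1m.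
(* The two sides are those of the balancing equation up to the permutation
   (H ⊗ X) ⊗ W -> (X ⊗ W) ⊗ H of the factors. *)
have K (a b : D) : ((braid (vhom a b) (X ⊗ (W b : V)) ∘ assoc _ _ _) ⊠ idm (F a : V)) ∘
    ((assoc_inv _ _ _ ∘ braid _ _) ⊠ idm _) = idm _.
  by rewrite -tens_compl -compA (reassoc_id (assocKV _ _ _)) braidK tens1.
split=> fP a b.
  by apply: (cancel_epi (K a b)); rewrite -L -R fP.
by apply: uncurry_injective; rewrite L R fP.
Qed.

Section UniversalProperty.
Variables (D : VCat V) (W : VFunctor (vop D) (Vself V)) (F : VFunctor D (Vself V)).
Variables (c : V) (lam : forall d : D, Hom (W d : V) (ihom (F d) c)).

Definition hom_cocone x (d : D) : Hom (ihom c x) (ihom (W d) (ihom (F d) x)) :=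
  curry (ihom_comp (F d) c x ∘ (idm (ihom c x) ⊠ lam d)).

Definition colimit_hom x : Prop :=
  @is_functor_hom V (vop D) (Vself V) W
    (vfun_comp (vrepr (A := vop (Vself V)) x) (vfun_op F)) (ihom c x) (hom_cocone x).

Lemma uncurry_hom_cocone x X (h : Hom X (ihom c x)) d :
  uncurry (uncurry (hom_cocone x d ∘ h)) =
  uncurry h ∘ ((idm X ⊠ uncurry (lam d)) ∘ assoc _ _ _).
Proof.
by rewrite (uncurry_comp _ h) curryK -compA -tensM comp1m compm1 uncurry_ihom_comp.
Qed.

Lemma colimit_hom_universal x :
  colimit_hom x -> universal_at (ract W) (lact F) (fun d => uncurry (lam d)) x.
Proof.
move=> [_ U] g gP.
(* The V-natural family with domain I whose components name the transposes of g. *)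
pose f d : Hom munit (ihom (W d) (ihom (F d) x)) := name (curry (g d)).
have fE d : uncurry (uncurry (f d)) = g d ∘ (lunit (W d : V) ⊠ idm (F d : V)).
  by rewrite curryK uncurry_comp curryK.
have [|h [hE hU]] := U munit f.
  apply/vnatural_family_balanced => a b; rewrite !fE -!compA.
  rewrite -tens_compl /tensl_act (reassoc (lunit_nat _)) lunit_tens tens_compl.
  by rewrite (reassoc1 (gP a b)) -(reassoc (tens_swap _ _)) -!compA assoc_nat tens1.
exists (uncurry h ∘ lunit_inv c); split=> [d|k kE].
  rewrite -compA lunit_inv_nat -lunit_inv_tens (compA (_ ⊠ uncurry _)).
  rewrite compA -uncurry_hom_cocone hE fE -compA -tens_compl lunitKV tens1.
  by rewrite compm1.
have -> : h = name k.
  apply: hU => d; do 2! apply: uncurry_injective.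
  rewrite uncurry_hom_cocone fE curryK -kE -!compA (reassoc (lunit_nat _)).
  by rewrite lunit_tens.
by rewrite curryK -compA lunitKV compm1.
Qed.

(** The enriched universal property has a parameter X, which the coend absorbs
    by [coend_tensl]. *)
Lemma coend_colimit_hom x :
  is_coend (ract W) (lact F) (fun d => uncurry (lam d)) -> colimit_hom x.
Proof.
move=> lamP; have PU X := coend_tensl X lamP.
split=> [|X f /vnatural_family_balanced fP].
  apply/vnatural_family_balanced.
  have [P _] := PU (ihom c x); move: (balanced_comp (ev c x) P) => {}P a b.
  have E d : uncurry (uncurry (hom_cocone x d)) =
    ev c x ∘ ((idm _ ⊠ uncurry (lam d)) ∘ assoc _ _ _).
    by rewrite -[hom_cocone x d]compm1 uncurry_hom_cocone ev_uncurry.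
  by rewrite !E P.
have [_ /(_ x _ fP) [k [kE kU]]] := PU X.
exists (curry k); split=> [d|h hE].
  by do 2! apply: uncurry_injective; rewrite uncurry_hom_cocone curryK kE.
rewrite -[h]uncurryK; congr curry; apply: kU => d.
by rewrite -hE uncurry_hom_cocone.
Qed.

Lemma colimitP : is_colimit (A := Vself V) (W := W) (F := F) (c := c) lam <->
  is_coend (ract W) (lact F) (fun d => uncurry (lam d)).
Proof.
split=> [[/colimit_unit_balanced lamP lamU]|lamP].
  by split=> // x; apply/colimit_hom_universal/lamU.
split; first by apply/colimit_unit_balanced; case: lamP.
by move=> x; apply: (coend_colimit_hom x).
Qed.

End UniversalProperty.

Lemma lactM (T : VFunctor (Vself V) (Vself V)) x y z :
  lact T x z ∘ (ihom_comp x y z ⊠ idm (T x : V)) =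
  lact T y z ∘ ((idm (ihom y z) ⊠ lact T x y) ∘ assoc _ _ _).
Proof.
have := congr1 (@uncurry V _ _ _) (vfmorM T x y z).
by rewrite uncurry_comp uncurry_ihom_comp.
Qed.

Lemma lact_compE A (F : VFunctor A (Vself V)) (T : VFunctor (Vself V) (Vself V)) (a b : A) :
  lact (vfun_comp T F) a b = lact T (F a) (F b) ∘ (vfmor F a b ⊠ idm _).
Proof. by rewrite /lact /= uncurry_comp. Qed.

Lemma lact_vrepr A (F : VFunctor A (Vself V)) x (a b : A) :
  lact (vfun_comp (vrepr (A := Vself V) x) F) a b =
  ihom_comp x (F a) (F b) ∘ (vfmor F a b ⊠ idm _).
Proof. by rewrite /lact /= uncurry_comp curryK. Qed.

Lemma lact_vid (T : VFunctor (Vself V) (Vself V)) x :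
  lact T x x ∘ (@vid V (Vself V) x ⊠ idm _) = lunit _.
Proof. by rewrite -uncurry_comp vfmor1 curryK. Qed.

End Colimits.

(** * Sifted colimits commute with finite powers *)

Section Sifted.
Variable V : SMCC.
Implicit Types x y z X Y : V.
Variable K : FinCopowers V.

(** Locked so that rewriting with the category laws does not see the composite. *)
Definition point (n : finType) (j : n) y : Hom (ihom (cop K n) y) y :=
  locked (ev _ _ ∘ ((idm _ ⊠ copin K j) ∘ runit_inv _)).

Lemma pointE (n : finType) (j : n) x y (h : Hom x (ihom (cop K n) y)) :
  point j y ∘ h = uncurry h ∘ ((idm _ ⊠ copin K j) ∘ runit_inv _).
Proof.
rewrite /point -lock -!compA runit_inv_nat (reassoc (tens_swap _ _)).
by rewrite (reassoc1 (uncurryE _)).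
Qed.

Lemma point_comp (n : finType) (j : n) y z :
  point j z ∘ ihom_comp (cop K n) y z = ev y z ∘ (idm _ ⊠ point j y).
Proof.
rewrite pointE curryK -!compA -tens1 (reassoc (assoc_nat _ _ _)) assoc_runit_inv.
by rewrite -!tens_compr -[point j y]compm1 pointE -ev_uncurry.
Qed.

(** As K n is the n-fold copower of I, [K n, y] is the n-fold power of y. *)
Lemma point_product (n : finType) y : is_product (fun j : n => point j y).
Proof.
move=> x f.
pose k := copdesc K (fun j : n => lcurry (f j ∘ runit x)).
exists (curry (luncurry k)); split=> [j|h hE].
  rewrite pointE curryK compA -luncurry_comp copdescE lcurryK.
  by rewrite -compA runitKV compm1.
rewrite -[h]uncurryK -[uncurry h]lcurryK; congr (curry (luncurry _)).
apply: cop_eq => j; rewrite copdescE lcurry_comp; congr lcurry.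
by rewrite -hE pointE -!compA runitK compm1.
Qed.

Section Colimit.
Variables (D : VCat V) (W : VFunctor (vop D) (Vself V)) (F : VFunctor D (Vself V)).
Variables (c : V) (lam : forall d : D, Hom (W d : V) (ihom (F d) c)).
Hypothesis lamP : is_colimit (A := Vself V) (W := W) (F := F) (c := c) lam.

Definition power_cocone x (d : D) : Hom ((W d : V) ⊗ ihom x (F d)) (ihom x c) :=
  ihom_comp x (F d) c ∘ (lam d ⊠ idm _).

Lemma power_cocone_balanced x :
  balanced (ract W) (lact (vfun_comp (vrepr (A := Vself V) x) F)) (power_cocone x).
Proof.
have [/colimit_unit_balanced lamB _] := lamP.
have E a b : lam a ∘ ract W a b = ihom_comp (F a) (F b) c ∘ (lam b ⊠ vfmor F a b).
  by apply: uncurry_injective; rewrite uncurry_comp uncurry_ihom_comp lamB.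
move=> a b; rewrite /power_cocone -!compA -tens_compl E tens_compl.
rewrite (reassoc (ihom_compA _ _ _ _)) -!compA assoc_nat lact_vrepr.
rewrite tens_compr -!compA -(reassoc (tens_swap _ _)).
by rewrite (reassoc1 (esym (tens_split _ _))) -assoc_nat.
Qed.

(** [K n, c] is the colimit of [K n, F-]: siftedness makes the colimit of
    [K n, F-] a power of c, so the comparison with [K n, c] is invertible. *)
Lemma sifted_power (V_cocomplete : is_cocomplete (Vself V)) (n : finType) :
  is_small D -> is_sifted W ->
  is_coend (ract W) (lact (vfun_comp (vrepr (A := Vself V) (cop K n)) F))
    (power_cocone (cop K n)).
Proof.
move=> Dsmall Wsifted.
set P := vfun_comp (vrepr _) F.
have [c' [mu muP]] := V_cocomplete D W P Dsmall.
have /colimitP [muB muU] := muP.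
have [k [kE _]] := muU _ _ (power_cocone_balanced (cop K n)).
(* k compares W * [K n, F-] with [K n, c]; siftedness says that its composites
   with the projections present its source as the power of c. *)
have q_prod : is_product (fun j : n => point j c ∘ k).
  apply: (Wsifted n (fun=> F) P (fun j d => point j (F d)) _ _ c' mu (fun=> c)
    (fun=> lam)) => //.
  - move=> j; apply/is_vnat_self => a b; rewrite lact_vrepr (compA (point _ _)) point_comp -!compA.
    by rewrite tens_swap (reassoc1 (uncurryE _)).
  - by move=> d; apply: point_product.
  - move=> j d; apply: uncurry_injective; rewrite vpost_self vpre_self.
    rewrite !uncurry_comp !curryK -!compA !uncurryE (kE d) /power_cocone.
    by rewrite (compA (point _ _)) point_comp -!compA.
have k_iso : is_iso k.
  have [g [gE _]] := q_prod _ (fun j => point j c).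
  exists g; split.
    have [h [_ hU]] := q_prod _ (fun j => point j c ∘ k).
    rewrite -(hU (idm _)) => [|j]; last by rewrite compm1.
    by apply/esym/hU => j; rewrite compA gE.
  have [h [_ hU]] := point_product (fun j : n => point j c).
  rewrite -(hU (idm _)) => [|j]; last by rewrite compm1.
  by apply/esym/hU => j; rewrite compA gE.
by apply: coend_ext (coend_iso k_iso (conj muB muU)).
Qed.

End Colimit.
End Sifted.

(** * Objects at which T agrees with the extension of its restriction *)

Section Generated.
Variable V : SMCC.
Implicit Types c x y z : V.
Variables (K : FinCopowers V) (T : VFunctor (Vself V) (Vself V)).

(** The canonical comparison from the value of Lan_K (T K) at c to T c is
    invertible. *)
Definition generated (c : V) : Prop :=
  @is_coend V finType (fun n m => ihom (cop K n) (cop K m))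
    (fun n => ihom (cop K n) c) (fun n => T (cop K n))
    (fun n m => ihom_comp (cop K n) (cop K m) c)
    (fun n m => lact T (cop K n) (cop K m))
    (T c) (fun n => lact T (cop K n) c).

(** The weight [K -, c] and the diagram T K act by composition and by T, so this is
    [colimitP] for the colimits that define the Kan extension. *)
Lemma strongly_finitaryP : strongly_finitary K T <-> forall c, generated c.
Proof.
have E1 c (n m : SetFin K) :
  ract (vfun_comp (vrepr (A := vop (Vself V)) c) (vfun_op (SetFin_incl K))) n m =
    ihom_comp (cop K n) (cop K m) c.
  by rewrite /ract lact_contra tens1 comp1m -compA braidK compm1.
have E2 (n m : SetFin K) : lact (vfun_comp T (SetFin_incl K)) n m =
    lact T (cop K n) (cop K m).
  by rewrite lact_compE tens1 compm1.
have E3 c (n : SetFin K) :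
    uncurry (@vpre V (Vself V) _ _ (T c) (vid (T (cop K n))) ∘ vfmor T (cop K n) c) =
    lact T (cop K n) c.
  by rewrite vpre_id comp1m.
split=> gP c.
  have /colimitP := gP c.
  by apply: coend_ext => [n m|n m|n]; [apply: E1 | apply: E2 | apply: E3].
apply/colimitP; apply: coend_ext (gP c) => [n m|n m|n].
- exact: esym (E1 c n m).
- exact: esym (E2 n m).
- exact: esym (E3 c n).
Qed.

(** If c' is a retract of c, a factorisation through T c restricts along
    T c' -> T c; T is used on elements I -> [x, y] of the hom-objects, through
    the maps [tmap]. *)
Lemma generated_retract (c c' : V) (f : Hom munit (ihom c c')) (g : Hom munit (ihom c' c)) :
  @vpost V (Vself V) c' c c' f ∘ g = @vid V (Vself V) c' -> generated c -> generated c'.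
Proof.
move=> fg [_ cU]; split; first by move=> n m; apply: lactM.
move=> z b bP.
pose tmap x y (h : Hom munit (ihom x y)) : Hom (T x : V) (T y) :=
  lact T x y ∘ ((h ⊠ idm _) ∘ lunit_inv _).
have tmap_nat x y w (h : Hom munit (ihom x y)) :
   tmap x y h ∘ lact T w x = lact T w y ∘ (@vpost V (Vself V) w x y h ⊠ idm _).
  rewrite /tmap -!compA lunit_inv_nat -(reassoc (tens_swap _ _)) -lunit_inv_tens.
  rewrite -tens1 -(reassoc (assoc_nat _ _ _)) /vpost !tens_compl.
  by rewrite [RHS]compA (lactM T w x y) -!compA.
have tmap_retr : tmap c c' f ∘ tmap c' c g = idm _.
  rewrite [tmap c' c g]/tmap compA tmap_nat -compA (reassoc1 (esym (tens_compl _ _ _))).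
  by rewrite fg compA lact_vid lunitKV.
pose fs n := @vpost V (Vself V) (cop K n) c c' f.
pose gs n := @vpost V (Vself V) (cop K n) c' c g.
have fgs n : fs n ∘ gs n = idm _ by rewrite -(@vpost_comp V (Vself V)) fg vpost_id.
have [|h [hE hU]] := cU z (fun n => b n ∘ (fs n ⊠ idm _)).
  move=> n m; rewrite -!compA -tens_compl (@vpost_vcomp V (Vself V)) tens_compl.
  rewrite (reassoc (bP n m)) -!compA -(reassoc (tens_swap _ _)) -tens1.
  by rewrite assoc_nat.
exists (h ∘ tmap c' c g); split=> [n|k kE].
  by rewrite -compA tmap_nat compA hE -compA -tens_compl fgs tens1 compm1.
rewrite (hU (k ∘ tmap c c' f)) => [|n]; first by rewrite -compA tmap_retr compm1.
by rewrite -compA tmap_nat compA kE.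
Qed.

Lemma generated_cop (n : finType) : generated (cop K n).
Proof.
split; first by move=> m m'; apply: lactM.
move=> z b bP.
(* The Yoneda argument: evaluate b at the identity of K n. *)
pose u : Hom munit (ihom (cop K n) (cop K n)) := curry (lunit (cop K n)).
have uT : lact T (cop K n) (cop K n) ∘ (u ⊠ idm _) = lunit _ := lact_vid T (cop K n).
exists (b n ∘ ((u ⊠ idm _) ∘ lunit_inv _)); split=> [m|k kE].
  have /= bmn := bP m n.
  rewrite -!compA lunit_inv_nat -(reassoc (tens_swap _ _)) -lunit_inv_tens.
  rewrite -tens1 -(reassoc (assoc_nat _ _ _)) (compA _ (assoc _ _ _)) compA -bmn.
  by rewrite -!compA -!tens_compl (compA (ihom_comp _ _ _)) ihom_comp1m lunitKV tens1 compm1.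
by rewrite -kE -!compA (reassoc1 uT) lunitKV compm1.
Qed.

(** Both conditions concern the double coend of W d ⊗ [K n, F d] ⊗ T (K n): the
    left one after integrating over d, by [sifted_power], the right one after
    integrating over n, as the F d are generated. *)
Lemma generated_colimit (D : VCat V) (W : VFunctor (vop D) (Vself V))
    (F : VFunctor D (Vself V)) c (lam : forall d : D, Hom (W d : V) (ihom (F d) c)) :
  is_cocomplete (Vself V) ->
  is_colimit (A := Vself V) (W := W) (F := F) (c := c) lam ->
  is_small D -> is_sifted W -> (forall d : D, generated (F d)) ->
  generated c <-> is_colimit (A := Vself V) (W := W) (F := vfun_comp T F) (c := T c)
    (fun d => vfmor T (F d) c ∘ lam d).
Proof.
move=> V_cocomplete lamP Dsmall Wsifted FP; apply: iff_trans (iff_sym (colimitP _)).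
apply: (coend_assoc (fun n => sifted_power K lamP V_cocomplete n Dsmall Wsifted) FP).
- move=> d n m; rewrite /power_cocone /tensl_act -!compA.
  rewrite -(reassoc (tens_swap _ _)) -tens1 -assoc_nat tens_compl.
  by rewrite (reassoc (ihom_compA _ _ _ _)) -!compA.
- move=> n a b; rewrite /tensr_act lact_vrepr lact_compE tens_compl -!compA.
  rewrite (reassoc (lactM _ _ _ _)) -!compA (reassoc (assoc_nat _ _ _)) assocKV compm1.
  by rewrite tens1 tens_swap.
- move=> d n; rewrite /power_cocone tens_compl (reassoc (lactM _ _ _ _)) -!compA.
  by rewrite assoc_nat tens1 (reassoc (tens_swap _ _)) uncurry_comp -!compA.
Qed.

End Generated.

(** * Equivalences and full subcategories *)

Section Equivalences.
Implicit Types C D : Category.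

Lemma is_iso_fmap C D (F : Functor C D) (x y : C) (f : Hom x y) :
  is_iso f -> is_iso (fmap F f).
Proof.
by move=> [g [gf fg]]; exists (fmap F g); rewrite -!fmapM gf fg !fmap1.
Qed.

Lemma is_iso_comp C (x y z : C) (g : Hom y z) (f : Hom x y) :
  is_iso g -> is_iso f -> is_iso (g ∘ f).
Proof.
move=> [g' [Eg Eg']] [f' [Ef Ef']]; exists (f' ∘ g').
by rewrite -!compA (reassoc_id Eg) (reassoc_id Ef').
Qed.

Lemma equivalence_surjective C D (F : Functor C D) : is_equivalence F ->
  forall y, exists x, exists f : Hom (F x) y, is_iso f.
Proof. by move=> [G [_ [e [_ eP]]]] y; exists (G y), (e y); apply: eP. Qed.

Lemma equivalence_reflects C D (F : Functor C D) : is_equivalence F ->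
  forall x y (f : Hom (F x) (F y)), is_iso f -> exists g : Hom x y, is_iso g.
Proof.
move=> [G [[e [_ eP]] _]] x y f fP; have [e' [E1 E2]] := eP x.
exists (e y ∘ (fmap G f ∘ e')); apply: is_iso_comp (eP y) _.
by apply: is_iso_comp (is_iso_fmap G fP) _; exists (e x).
Qed.

End Equivalences.

Section FullSub.
Variable V : SMCC.
Variable P : V -> Prop.

Definition full_sub_vcat : VCat V :=
  {| vob := {c : V | P c};
     vhom x y := ihom (sval x) (sval y);
     vid x := @vid V (Vself V) (sval x);
     vcomp x y z := ihom_comp (sval x) (sval y) (sval z);
     vcompA x y z w := ihom_compA (sval x) (sval y) (sval z) (sval w);
     vcomp1m x y := ihom_comp1m (sval x) (sval y);
     vcompm1 x y := ihom_compm1 (sval x) (sval y) |}.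

(** The composite of F with the inclusion, defined directly so that its action
    on hom-objects is convertible to that of F. *)
Definition sub_value (A : VCat V) (F : VFunctor A full_sub_vcat) :
    VFunctor A (Vself V) :=
  @Build_VFunctor V A (Vself V) (fun a => sval (F a)) (fun a b => vfmor F a b)
    (vfmor1 F) (vfmorM F).

Section Colim.
Variables (D : VCat V) (W : VFunctor (vop D) (Vself V)) (F : VFunctor D full_sub_vcat).
Variables (c : full_sub_vcat) (lam : forall d : D, Hom (W d : V) (vhom (F d) c)).

Lemma sub_colimit :
  is_colimit (A := Vself V) (W := W) (F := sub_value F) (c := sval c) lam ->
  is_colimit (A := full_sub_vcat) (W := W) (F := F) (c := c) lam.
Proof.
by move=> [lamN lamU]; split=> [|x]; [exact: lamN | exact: (lamU (sval x))].
Qed.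

(** Once the subcategory contains some colimit computed in V, its own colimit is
    isomorphic to that one by uniqueness of colimits. *)
Lemma sub_colimit_inv (c' : V) (lam' : forall d : D, Hom (W d : V) (ihom (sval (F d)) c')) :
  P c' -> is_colimit (A := Vself V) (W := W) (F := sub_value F) (c := c') lam' ->
  is_colimit (A := full_sub_vcat) (W := W) (F := F) (c := c) lam ->
  is_colimit (A := Vself V) (W := W) (F := sub_value F) (c := sval c) lam.
Proof.
move=> Pc' /colimitP [lB' lU'] [lamN lamU].
have lB : balanced (ract W) (lact (sub_value F)) (fun d => uncurry (lam d)).
  exact/colimit_unit_balanced.
have lU z : P z ->
    universal_at (ract W) (lact (sub_value F)) (fun d => uncurry (lam d)) z.
  by move=> Pz; apply: colimit_hom_universal; exact: (lamU (exist _ z Pz)).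
have [h [hE _]] := lU' _ _ lB; have [g [gE _]] := lU c' Pc' _ lB'.
(* h and g are the comparisons between the colimit in V and the one in the
   subcategory, which exist because both objects lie in the subcategory. *)
suff h_iso : is_iso h.
  by apply/colimitP; apply: coend_ext (coend_iso h_iso (conj lB' lU')).
exists g; split.
  by apply: (universal_at_inj lB' (lU' c')) => d; rewrite -compA hE gE comp1m.
apply: (universal_at_inj lB (lU _ (svalP c))) => d.
by rewrite -compA gE hE comp1m.
Qed.

End Colim.
End FullSub.

(** * Strongly finitary endofunctors and sifted colimits *)

Section Main.
Variable V : SMCC.
Variables (K : FinCopowers V) (T : VFunctor (Vself V) (Vself V)).
Hypothesis V_cocomplete : is_cocomplete (Vself V).

Lemma strongly_finitary_preserves : strongly_finitary K T -> preserves_sifted_colimits T.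
Proof.
move=> /strongly_finitaryP gP D W F c lam Dsmall Wsifted lamP.
exact/(generated_colimit V_cocomplete lamP Dsmall Wsifted).
Qed.

Hypothesis T_sifted : preserves_sifted_colimits T.

(** The colimit taken in V is preserved by T, hence generated by
    [generated_colimit]. *)
Lemma generated_closed (D : VCat V) (W : VFunctor (vop D) (Vself V))
    (F : VFunctor D (full_sub_vcat (generated K T))) :
  is_small D -> is_sifted W ->
  exists (c : full_sub_vcat (generated K T))
    (lam : forall d : D, Hom (W d : V) (ihom (sval (F d)) (sval c))),
    is_colimit (A := Vself V) (W := W) (F := sub_value F) (c := sval c) lam.
Proof.
move=> Dsmall Wsifted; have [c [lam lamP]] := V_cocomplete W (sub_value F) Dsmall.
suff cP : generated K T c by exists (exist _ c cP), lam.
apply/(generated_colimit V_cocomplete lamP Dsmall Wsifted).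
  by move=> d; apply: (svalP (F d)).
exact: T_sifted.
Qed.

(** Freeness of V is applied twice: for the category of generated objects, where
    it yields the extension R of K, and for V itself, where it identifies R with
    the identity. *)
Lemma preserves_strongly_finitary : is_Sind_SetFin K -> strongly_finitary K T.
Proof.
move=> V_Sind; apply/strongly_finitaryP.
set L := full_sub_vcat (generated K T).
have L_sifted : has_sifted_colimits L.
  move=> D W F Dsmall Wsifted.
  have [c [lam lamP]] := generated_closed F Dsmall Wsifted.
  by exists c, lam; apply: sub_colimit.
have V_sifted : has_sifted_colimits (Vself V).
  by move=> D W F Dsmall _; apply: V_cocomplete.
(* K factors through L by [generated_cop]; R is the extension of the
   corestriction K' along K. *)
pose K' : VFunctor (SetFin K) L := @Build_VFunctor V (SetFin K) L
  (fun n => exist _ (cop K n) (generated_cop K T n)) (fun n m => idm _)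
  (@vfmor1 _ _ _ (SetFin_incl K)) (@vfmorM _ _ _ (SetFin_incl K)).
have [[R R_sifted] [f [g [gf fg]]]] := equivalence_surjective (V_Sind L L_sifted) K'.
pose JR : VFunctor (Vself V) (Vself V) := sub_value R.
(* The inclusion of L preserves sifted colimits, as those of L can be computed
   in V. *)
have JR_sifted : preserves_sifted_colimits JR.
  move=> D W F c lam Dsmall Wsifted lamP.
  have RP := R_sifted D W F c lam Dsmall Wsifted lamP.
  have [c' [lam' lamP']] := generated_closed (vfun_comp R F) Dsmall Wsifted.
  exact: (sub_colimit_inv (svalP c') lamP' RP).
pose Id : VFunctor (Vself V) (Vself V) := @Build_VFunctor V (Vself V) (Vself V)
  id (fun x y => idm _) (fun x => comp1m _) (fun x y z => etrans (comp1m _)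
   (etrans (esym (compm1 _)) (congr1 (comp _) (esym (tens1 _ _))))).
have Id_sifted : preserves_sifted_colimits Id.
  move=> D W F c lam Dsmall Wsifted /colimitP lamP; apply/colimitP.
  apply: coend_ext lamP => // d *; last by rewrite comp1m.
  by rewrite /lact /= comp1m.
pose SV := full_subcategory (C := VFunCat (Vself V) (Vself V))
   (@preserves_sifted_colimits V (Vself V) (Vself V)).
pose oJR : SV := exist _ JR JR_sifted.
pose oId : SV := exist _ Id Id_sifted.
pose PV := precomposition (@preserves_sifted_colimits V (Vself V) (Vself V)) (SetFin_incl K).
(* R K and K' are isomorphic, hence so are the composites of JR and Id with K;
   the components are the same morphisms of V. *)
have fN : @is_vnat _ _ _ (PV oJR) (PV oId) f.
  by move=> a b; rewrite /= comp1m; exact: (vntm_nat f).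
have gN : @is_vnat _ _ _ (PV oId) (PV oJR) g.
  by move=> a b; rewrite /= comp1m; exact: (vntm_nat g).
have fg_iso : is_iso (C := VFunCat _ _) (Build_VNat fN).
  exists (Build_VNat gN); split; apply: vnat_ext => n.
    exact: (congr1 (fun h => vntm h n) gf).
  exact: (congr1 (fun h => vntm h n) fg).
(* Hence JR and Id are isomorphic, and c is a retract of the generated JR c. *)
have [t [s [_ ts]]] := equivalence_reflects (V_Sind _ V_sifted) (x := oJR) (y := oId) fg_iso.
move=> c; apply: (@generated_retract _ K T (JR c) c (t c) (s c)).
  exact: (congr1 (fun h : VNat Id Id => vntm h c) ts).
exact: (svalP (R c)).
Qed.

End Main.

Theorem proposition5p3 (V : SMCC)
    (V_complete : is_complete (Vself V)) (V_cocomplete : is_cocomplete (Vself V))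
    (K : FinCopowers V) (K_full_embedding : fully_faithful (copower_functor K))
    (V_Sind : is_Sind_SetFin K) (T : VFunctor (Vself V) (Vself V)) :
  strongly_finitary K T <-> preserves_sifted_colimits T.
Proof.
split; first exact: strongly_finitary_preserves.
by move=> T_sifted; apply: preserves_strongly_finitary.
Qed.
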